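(* There exist absolute constants $c,C>0$ such that the following holds. Let $N,q$ be positive integers, let $\delta>0$, and let $g_0,g_1,f:\mathbb{Z}\to\mathbb{C}$ be 1-bounded functions, each supported in $[N]$. Suppose that $$\left|\sum_{x\in\mathbb{Z}}\sum_{y\in\mathbb{N}}g_0(x)g_1(x+y)f(x+qy^2)\right|\geq\delta\sum_{x\in\mathbb{Z}}\sum_{y\in\mathbb{N}}1_{[N]}(x)1_{[N]}(x+y)1_{[N]}(x+qy^2).$$ Then either $N\leq Cq$ or $$\sum_{u\in[q]}\|f\|_{U^5(u+q\mathbb{Z})}^{2^5}\geq c\,\delta^{C}\sum_{u\in[q]}\|1_{[N]}\|_{U^5(u+q\mathbb{Z})}^{2^5}.$$
   Context: $\mathbb{N}$ denotes the positive integers and $[X]=\{1,\dots,\lfloor X\rfloor\}$. A function is 1-bounded if its modulus never exceeds 1. For $f:\mathbb{Z}\to\mathbb{C}$ put $\Delta_hf(x)=f(x)\overline{f(x+h)}$ and $\Delta_{h_1,\dots,h_s}f=\Delta_{h_1}\cdots\Delta_{h_s}f$. For finitely supported $f$ the (unnormalised) Gowers norm is $$\|f\|_{U^s}=\Big(\sum_{x,h_1,\dots,h_s\in\mathbb{Z}}\Delta_{h_1,\dots,h_s}f(x)\Big)^{1/2^s},$$ and for $S\subset\mathbb{Z}$ the localised Gowers norm is $\|f\|_{U^s(S)}:=\|f1_S\|_{U^s}$. Here $u+q\mathbb{Z}$ is the residue class of $u$ modulo $q$. *)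

(* Defs.v *)
From HB Require Import structures.
From mathcomp Require Export all_boot all_order all_algebra.
From mathcomp Require Export all_classical all_reals all_analysis.
From mathcomp Require Export complex.
Set Implicit Arguments.
Unset Strict Implicit.
Unset Printing Implicit Defensive.
Export Order.TTheory GRing.Theory Num.Theory.
Local Open Scope classical_set_scope.
Local Open Scope ring_scope.

Definition initial_segment (n : nat) : set int :=
  [set x : int | (1 <= x <= n%:Z)].

Definition residue_class (u : int) (q : nat) : set int :=
  [set u + q%:Z * k | k in [set: int]].

Section Functions.
Variable R : rcfType.
Implicit Types (f : int -> R[i]) (S : set int).

Definition one_bounded f : Prop := forall x, `|f x| <= 1.

Definition supported_in f S : Prop := forall x, ~ S x -> f x = 0.

Definition indicator S : int -> R[i] := \1_S.

Definition mul_diff (h : int) f : int -> R[i] :=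
  fun x => f x * (f (x + h))^*.

(* [mul_diffs [:: h_1; ...; h_s] f] is $\Delta_{h_1} \cdots \Delta_{h_s} f$. *)
Definition mul_diffs (hs : seq int) f : int -> R[i] := foldr mul_diff f hs.

Definition quadratic_count (q : nat) (g0 g1 f : int -> R[i]) : R[i] :=
  \sum_(x \in [set: int]) \sum_(y \in [set y : nat | (0 < y)%N])
    g0 x * g1 (x + y%:Z) * f (x + q%:Z * y%:Z ^+ 2).

End Functions.

Section GowersNorm.
Variable R : realType.
Implicit Types (f : int -> R[i]) (S : set int).

(* The sums [\sum_(_ \in _)] have only finitely many nonzero terms when [f] is
   finitely supported (and default to 0 otherwise).  For finitely supported [f]
   and $s \geq 1$ the sum is a nonnegative real number, so that taking its real
   part only turns it into an element of [R]. *)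
Definition gowers_norm (s : nat) f : R :=
  complex.Re (\sum_(x \in [set: int]) \sum_(h \in [set: s.-tuple int])
                 mul_diffs h f x) `^ ((2 ^ s)%:R^-1).

Definition local_gowers_norm (s : nat) S f : R :=
  gowers_norm s (fun x => f x * indicator R S x).

End GowersNorm.

(* Main.v *)
Require Import Defs.
From mathcomp Require Import ring lra zify.
Set Implicit Arguments.
Unset Strict Implicit.
Unset Printing Implicit Defensive.
Local Open Scope ring_scope.

(** Put M = floor (sqrt (N / q)), so that only y <= M matter, and compare
    everything with the trivial count N M.  The theorem is true because
    repeated use of the Cauchy-Schwarz inequality removes g0 and g1 and
    replaces the quadratic shifts of f by linear ones, after which the linear
    shifts can be made to run over whole intervals of multiples of q.  At every
    stage the loss is polynomial in the density, and no arithmetic enters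
    beyond the fact that two integers rarely have a large common factor.

    Both sides are transported to the cyclic group G of order 200 N, where
    translation is exact, and written with normalised averages E; let D_h f
    denote x |-> f(x) conj f(x + h) and r = 2 q.

    (1) Shifting y by a + b and translating x by -b turns the count into an
    average of g0(x - b) g1(x + y + a) f(x - b + q (y + a + b)^2), in which each
    of the two weights misses one of the parameters a, b; the box inequality
    removes them ([quadratic_box]).  For fixed values d, e of the differences
    of a and of b the remaining four arguments of f are linear in y, with
    slopes 0, r d, r e, r (d + e).  A three-dimensional box inequality
    ([linear_forms]) then leaves an average over d, e, h1, h2, h3 of
    E_x D_{r d h1} D_{r e h2} D_{r (d+e) h3} f(x); see [linearisation].

    (2) Products such as d h1 do not fill an interval evenly, but
    d h - d' h' does as soon as d and d' have a small common factor
    ([few_solutions]), and this holds for most pairs ([card_degenerate]).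
    Replacing products by such differences costs one Cauchy-Schwarz step per
    product when the parameters of different directions are independent
    ([bilinear_concatenation]).  The parameters d, e, d + e are not; for fixed
    e the box in the directions d h1 and (d + e) h3 is therefore treated first
    ([box_concatenation]): pairing d with d' gives a configuration that the
    box inequality controls by one sparse direction and two dense ones.  What
    remains has two independent sparse directions, and two applications of
    [bilinear_concatenation] produce an average of |E_x D_{k1,k2,k3,k4} f(x)|
    over all multiples k_i of r in an interval: [group_quadratic_control].

    (3) Back in the integers, the 32nd power of the U^5 norm is the sum over
    quadruples h of the squares of |sum_x D_{h1,h2,h3,h4} f(x)|
    ([gowers_norm5E]).  A last Cauchy-Schwarz inequality, over the quadruples
    and over the residue classes modulo q, bounds the average in (2) by the sum
    of the localised norms ([cube_corr_gowers]), and counting points bounds the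
    norms of the indicator function ([local_gowers_one_le]). *)

(** * Normalised averages *)
Reserved Notation "\avg_ ( i : t ) F"
  (at level 34, F at level 36, i at level 50).
Reserved Notation "\avg_ ( i < n ) F"
  (at level 34, F at level 36, i, n at level 50).
Reserved Notation "\avg_ i F"
  (at level 34, F at level 36, i at level 0).

Definition avg (K : numFieldType) (I : finType) (F : I -> K) : K :=
  (\sum_i F i) / #|I|%:R.

Notation "\avg_ ( i : t ) F" := (avg (fun i : t => F)) : ring_scope.
Notation "\avg_ ( i < n ) F" := (avg (fun i : 'I_n => F)) : ring_scope.
Notation "\avg_ i F" := (avg (fun i => F)) : ring_scope.

Section AvgNumField.
Variable K : numFieldType.
Implicit Types I J : finType.

Lemma eq_avg I (F G : I -> K) : F =1 G -> avg F = avg G.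
Proof. by move=> FG; rewrite /avg (eq_bigr G). Qed.

Lemma exchange_avg I J (F : I -> J -> K) :
  \avg_i \avg_j F i j = \avg_j \avg_i F i j.
Proof.
rewrite /avg -!mulr_suml exchange_big /= -!mulrA; congr (_ * _).
by rewrite mulrC.
Qed.

Lemma pair_avg I J (F : I -> J -> K) :
  \avg_i \avg_j F i j = \avg_(p : I * J) F p.1 p.2.
Proof.
rewrite /avg -mulr_suml -mulrA -(pair_bigA _ F) /=; congr (_ * _).
by rewrite card_prod natrM invfM mulrC.
Qed.

Lemma avgZl I (c : K) (F : I -> K) : \avg_i (c * F i) = c * avg F.
Proof. by rewrite /avg -mulr_sumr mulrA. Qed.

Lemma avgZr I (c : K) (F : I -> K) : \avg_i (F i * c) = avg F * c.
Proof. by rewrite /avg -mulr_suml mulrAC. Qed.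

Lemma avgD I (F G : I -> K) : \avg_i (F i + G i) = avg F + avg G.
Proof. by rewrite /avg big_split mulrDl. Qed.

Lemma avgN I (F : I -> K) : \avg_i (- F i) = - avg F.
Proof. by rewrite /avg sumrN mulNr. Qed.

Lemma avgB I (F G : I -> K) : \avg_i (F i - G i) = avg F - avg G.
Proof. by rewrite avgD avgN. Qed.

Lemma avg_const I (c : K) : (0 < #|I|)%N -> \avg_(i : I) c = c.
Proof.
move=> I0; rewrite /avg sumr_const -[c *+ _]mulr_natr -mulrA mulfV ?mulr1//.
by rewrite pnatr_eq0 -lt0n.
Qed.

Lemma avgM I J (F : I -> K) (G : J -> K) :
  avg F * avg G = \avg_i \avg_j (F i * G j).
Proof. by under [RHS]eq_avg do rewrite avgZl; rewrite avgZr. Qed.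

Lemma avg_ge0 I (F : I -> K) : (forall i, 0 <= F i) -> 0 <= avg F.
Proof. by move=> F0; rewrite /avg divr_ge0 ?ler0n// sumr_ge0. Qed.

Lemma ler_avg I (F G : I -> K) : (forall i, F i <= G i) -> avg F <= avg G.
Proof.
by move=> FG; rewrite /avg ler_wpM2r ?invr_ge0 ?ler0n// ler_sum.
Qed.

Lemma ler_avg_const I (F : I -> K) (c : K) : 0 <= c ->
  (forall i, F i <= c) -> avg F <= c.
Proof.
move=> c0 Fc; have [I0|I0] := posnP #|I|.
  by rewrite /avg I0 invr0 mulr0.
by rewrite -[leRHS](avg_const (I:=I)) //; apply: ler_avg.
Qed.

Lemma reindex_avg I (h : I -> I) (F : I -> K) : injective h ->
  avg F = \avg_i F (h i).
Proof. by move=> hI; rewrite /avg (reindex_inj hI). Qed.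

End AvgNumField.

(** The variance of F is nonnegative. *)
Lemma avg_sqr_le (R : realFieldType) (I : finType) (F : I -> R) :
  avg F ^+ 2 <= \avg_i F i ^+ 2.
Proof.
have [I0|I0] := posnP #|I|.
  by rewrite /avg I0 invr0 !mulr0 expr0n.
set a := avg F.
have : 0 <= \avg_i (F i - a) ^+ 2 by apply: avg_ge0 => i; rewrite sqr_ge0.
rewrite (eq_avg (G := fun i => F i ^+ 2 + (- (a *+ 2) * F i + a ^+ 2))).
  rewrite avgD avgD avgZl avg_const// -/a => h.
  rewrite -subr_ge0; apply: le_trans h _.
  by rewrite le_eqVlt; apply/orP; left; apply/eqP; ring.
by move=> i; ring.
Qed.

Lemma avg_pow2_le (R : realFieldType) (I : finType) (F : I -> R) k :
  (forall i, 0 <= F i) -> avg F ^+ (2 ^ k) <= \avg_i F i ^+ (2 ^ k).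
Proof.
move=> F0; elim: k => [|k IHk]; first by rewrite expn0 expr1.
rewrite expnSr exprM (le_trans (y := (\avg_i F i ^+ (2 ^ k)) ^+ 2))//.
  rewrite ler_pXn2r ?nnegrE ?exprn_ge0// ?avg_ge0// => i.
  by rewrite exprn_ge0.
by apply: (le_trans (avg_sqr_le _)); apply: ler_avg => i; rewrite exprM.
Qed.

Lemma ler_expr_nonneg (R : numDomainType) (a b : R) n : 0 <= a -> a <= b -> a ^+ n <= b ^+ n.
Proof. by move=> a0 ab; rewrite lerXn2r ?nnegrE// (le_trans a0). Qed.

(** * Cauchy-Schwarz and box inequalities *)
Section ComplexModulus.
Variable R : rcfType.
Local Notation C := R[i].
Implicit Types (I J O T : finType) (z w : C).

(** The norm of a complex number lives in the complex numbers; this copy in R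
    makes the reasoning with total orders available. *)
Definition modulus z : R := complex.Re `|z|.

Definition bounded1 (T : Type) (f : T -> C) := forall x, modulus (f x) <= 1.

Lemma modulusE z : (modulus z)%:C%C = `|z|.
Proof. by rewrite /modulus RRe_real ?normr_real. Qed.

Lemma modulus_ge0 z : 0 <= modulus z.
Proof. by rewrite -lecR modulusE normr_ge0. Qed.

Lemma modulus_le z (r : R) : (modulus z <= r) = (`|z| <= r%:C%C).
Proof. by rewrite -modulusE lecR. Qed.

Lemma modulusM z w : modulus (z * w) = modulus z * modulus w.
Proof. by apply: complexI; rewrite rmorphM /= !modulusE normrM. Qed.

Lemma modulus_conj z : modulus z^* = modulus z.
Proof. by apply: complexI; rewrite !modulusE norm_conjC. Qed.

Lemma modulusD z w : modulus (z + w) <= modulus z + modulus w.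
Proof. by rewrite modulus_le rmorphD /= !modulusE ler_normD. Qed.

Lemma modulusN z : modulus (- z) = modulus z.
Proof. by apply: complexI; rewrite !modulusE normrN. Qed.

Lemma modulus_real (r : R) : modulus r%:C%C = `|r|.
Proof. by apply: complexI; rewrite modulusE normc_def /= expr0n addr0 sqrtr_sqr. Qed.

Lemma modulus0 : modulus 0 = 0.
Proof. by rewrite -(rmorph0 (real_complex R)) modulus_real normr0. Qed.

Lemma modulus1 : modulus 1 = 1.
Proof. by rewrite -(rmorph1 (real_complex R)) modulus_real normr1. Qed.

Lemma modulus_nat n : modulus n%:R = n%:R.
Proof. by rewrite -(rmorph_nat (real_complex R)) modulus_real normr_nat. Qed.

Lemma modulusV z : modulus z^-1 = (modulus z)^-1.
Proof. by apply: complexI; rewrite fmorphV /= !modulusE normfV. Qed.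

Lemma Re_modulus z : complex.Re z <= modulus z.
Proof.
rewrite -lecR modulusE; apply: le_trans (normc_ge_Re z).
by rewrite lecR ler_norm.
Qed.

Lemma mul_conj z : z * z^* = (modulus z ^+ 2)%:C%C.
Proof. by rewrite rmorphXn /= modulusE normCK. Qed.

Lemma modulus_sqr z : modulus z ^+ 2 = complex.Re (z * z^*).
Proof. by rewrite mul_conj. Qed.

Lemma ler_modulus_sum I (P : pred I) (F : I -> C) :
  modulus (\sum_(i | P i) F i) <= \sum_(i | P i) modulus (F i).
Proof.
elim/big_rec2: _ => [|i x y _ h]; first by rewrite modulus0.
by apply: le_trans (modulusD _ _) _; rewrite lerD2l.
Qed.

Lemma modulus_avg I (F : I -> C) : modulus (avg F) <= \avg_i modulus (F i).
Proof.
rewrite /avg modulusM modulusV modulus_nat ler_wpM2r ?invr_ge0 ?ler0n//.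
exact: ler_modulus_sum.
Qed.

Lemma Re_sum I (P : pred I) (F : I -> C) :
  complex.Re (\sum_(i | P i) F i) = \sum_(i | P i) complex.Re (F i).
Proof. by elim/big_rec2: _ => //= i x y _ <-; case: (F i) y => [a b] []. Qed.

Lemma Re_mulr (r : R) z : complex.Re (z * r%:C%C) = complex.Re z * r.
Proof. by case: z => a b /=; rewrite mulr0 subr0. Qed.

Lemma Re_avg I (F : I -> C) : complex.Re (avg F) = \avg_i complex.Re (F i).
Proof.
by rewrite /avg -(rmorph_nat (real_complex R)) -fmorphV Re_mulr Re_sum.
Qed.

Lemma eq_Re_le (r : R) z w : r <= complex.Re z -> z = w -> r <= complex.Re w.
Proof. by move=> rz <-. Qed.

Lemma conj_avg I (F : I -> C) : (avg F)^* = \avg_i (F i)^*.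
Proof. by rewrite /avg rmorphM fmorphV rmorph_nat rmorph_sum. Qed.

Lemma modulus_avg_sqr I (F : I -> C) :
  modulus (avg F) ^+ 2 = complex.Re (\avg_i \avg_j (F i * (F j)^*)).
Proof. by rewrite modulus_sqr conj_avg avgM. Qed.

Lemma modulusM_le1 z w : modulus z <= 1 -> modulus w <= 1 -> modulus (z * w) <= 1.
Proof. by move=> z1 w1; rewrite modulusM mulr_ile1 ?modulus_ge0. Qed.

Lemma bounded1_avg I (F : I -> C) : bounded1 F -> modulus (avg F) <= 1.
Proof. by move=> F1; apply: le_trans (modulus_avg F) _; apply: ler_avg_const. Qed.

(** The Cauchy-Schwarz step behind every box inequality: a bounded factor that
    does not depend on the inner parameter t disappears, at the price of
    doubling t. *)
Lemma drop_bounded_factor O T (b : O -> C) (Phi : O -> T -> C) : bounded1 b ->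
  modulus (\avg_o \avg_t (b o * Phi o t)) ^+ 2
    <= complex.Re (\avg_o \avg_t \avg_t' (Phi o t * (Phi o t')^*)).
Proof.
move=> b1; rewrite Re_avg; under [leRHS]eq_avg do rewrite -modulus_avg_sqr.
apply: le_trans (avg_sqr_le _).
rewrite ler_pXn2r ?nnegrE ?modulus_ge0 ?avg_ge0//; last first.
  by move=> o; exact: modulus_ge0.
apply: le_trans (modulus_avg _) _; apply: ler_avg => o.
by rewrite avgZl modulusM ler_piMl ?modulus_ge0.
Qed.

(** Each of the two weights misses one of the parameters s and t, so it is a
    bounded factor that drops out when that parameter is doubled. *)
Lemma box_cauchy_schwarz2 O T1 T2 (Phi : O -> T1 -> T2 -> C)
    (A : O -> T2 -> C) (B : O -> T1 -> C) :
  (forall o, bounded1 (A o)) -> (forall o, bounded1 (B o)) ->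
  modulus (\avg_o \avg_s \avg_t (Phi o s t * A o t * B o s)) ^+ 4
    <= complex.Re (\avg_o \avg_s \avg_s' \avg_t \avg_t'
         (Phi o s t * (Phi o s' t)^* * (Phi o s t' * (Phi o s' t')^*)^*)).
Proof.
move=> A1 B1.
rewrite (exprM _ 2 2).
have -> : \avg_o \avg_s \avg_t (Phi o s t * A o t * B o s) =
    \avg_(p : O * T2) \avg_s (A p.1 p.2 * (Phi p.1 s p.2 * B p.1 s)).
  rewrite -(pair_avg (fun o t => \avg_s (A o t * (Phi o s t * B o s)))).
  apply: eq_avg => o; rewrite exchange_avg; apply: eq_avg => t.
  by apply: eq_avg => s; ring.
set X := avg _.
have AO : bounded1 (fun p : O * T2 => A p.1 p.2) by move=> p; exact: A1.
have /le_trans/(_ (Re_modulus _)) := drop_bounded_factor (fun p s => Phi p.1 s p.2 * B p.1 s) AO.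
rewrite -/X => hX.
apply: le_trans (ler_expr_nonneg 2 (exprn_ge0 _ (modulus_ge0 _)) hX) _.
set Y := avg _.
have -> : Y = \avg_(p : O * T1 * T1) \avg_t (B p.1.1 p.1.2 * (B p.1.1 p.2)^* *
    (Phi p.1.1 p.1.2 t * (Phi p.1.1 p.2 t)^*)).
  rewrite -(pair_avg (fun q s' => \avg_t (B q.1 q.2 * (B q.1 s')^* *
    (Phi q.1 q.2 t * (Phi q.1 s' t)^*)))).
  rewrite -(pair_avg (fun o s => \avg_s' \avg_t (B o s * (B o s')^* *
    (Phi o s t * (Phi o s' t)^*)))).
  rewrite /Y -(pair_avg (fun o t => \avg_s \avg_s' (Phi o s t * B o s *
    (Phi o s' t * B o s')^*))).
  apply: eq_avg => o; rewrite exchange_avg; apply: eq_avg => s.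
  rewrite exchange_avg; apply: eq_avg => s'.
  by apply: eq_avg => t; rewrite rmorphM; ring.
have BO : bounded1 (fun p : O * T1 * T1 => B p.1.1 p.1.2 * (B p.1.1 p.2)^*).
  by move=> p; apply: modulusM_le1; rewrite ?modulus_conj; exact: B1.
have := drop_bounded_factor (fun p t => Phi p.1.1 p.1.2 t * (Phi p.1.1 p.2 t)^*) BO.
rewrite -(pair_avg (fun q s' => \avg_t \avg_t' (Phi q.1 q.2 t * (Phi q.1 s' t)^* *
    (Phi q.1 q.2 t' * (Phi q.1 s' t')^*)^*))).
by rewrite -(pair_avg (fun o s => \avg_s' \avg_t \avg_t' (Phi o s t * (Phi o s' t)^* *
    (Phi o s t' * (Phi o s' t')^*)^*))).
Qed.

(** Doubling s removes A and turns B, D into weights on (t, u) that still miss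
    one parameter each, which is the two-dimensional situation. *)
Lemma box_cauchy_schwarz3 O T1 T2 T3 (Phi : O -> T1 -> T2 -> T3 -> C)
    (Psi := fun o s s' t u => Phi o s t u * (Phi o s' t u)^*)
    (A : O -> T2 -> T3 -> C) (B : O -> T1 -> T3 -> C) (D : O -> T1 -> T2 -> C) :
  (forall o t, bounded1 (A o t)) -> (forall o t, bounded1 (B o t)) ->
  (forall o t, bounded1 (D o t)) ->
  modulus (\avg_o \avg_s \avg_t \avg_u
     (Phi o s t u * A o t u * B o s u * D o s t)) ^+ 8
    <= complex.Re (\avg_o \avg_s \avg_s' \avg_t \avg_t' \avg_u \avg_u'
         (Psi o s s' t u * (Psi o s s' t' u)^* *
          (Psi o s s' t u' * (Psi o s s' t' u')^*)^*)).
Proof.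
move=> A1 B1 D1.
rewrite (exprM _ 2 4).
have -> : \avg_o \avg_s \avg_t \avg_u (Phi o s t u * A o t u * B o s u * D o s t) =
    \avg_(p : O * T2 * T3) \avg_s (A p.1.1 p.1.2 p.2 *
      (Phi p.1.1 s p.1.2 p.2 * B p.1.1 s p.2 * D p.1.1 s p.1.2)).
  rewrite -(pair_avg (fun q u => \avg_s (A q.1 q.2 u *
    (Phi q.1 s q.2 u * B q.1 s u * D q.1 s q.2)))).
  rewrite -(pair_avg (fun o t => \avg_u \avg_s (A o t u *
    (Phi o s t u * B o s u * D o s t)))).
  apply: eq_avg => o; rewrite exchange_avg; apply: eq_avg => t.
  rewrite exchange_avg; apply: eq_avg => u.
  by apply: eq_avg => s; ring.
set X := avg _.
have AO : bounded1 (fun p : O * T2 * T3 => A p.1.1 p.1.2 p.2) by move=> p; exact: A1.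
have /le_trans/(_ (Re_modulus _)) :=
  drop_bounded_factor (fun p s => Phi p.1.1 s p.1.2 p.2 * B p.1.1 s p.2 * D p.1.1 s p.1.2) AO.
rewrite -/X => hX.
apply: le_trans (ler_expr_nonneg 4 (exprn_ge0 _ (modulus_ge0 _)) hX) _.
set Y := avg _.
pose O' := (O * T1 * T1)%type.
pose Phi' (p : O') t u := Psi p.1.1 p.1.2 p.2 t u.
pose B' (p : O') u := B p.1.1 p.1.2 u * (B p.1.1 p.2 u)^*.
pose D' (p : O') t := D p.1.1 p.1.2 t * (D p.1.1 p.2 t)^*.
have -> : Y = \avg_p \avg_t \avg_u (Phi' p t u * B' p u * D' p t).
  rewrite -(pair_avg (fun q s' => \avg_t \avg_u (Phi' (q, s') t u *
    B' (q, s') u * D' (q, s') t))).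
  rewrite -(pair_avg (fun o s => \avg_s' \avg_t \avg_u (Phi' (o, s, s') t u *
    B' (o, s, s') u * D' (o, s, s') t))).
  pose W o t u s s' := (Phi o s t u * B o s u * D o s t) *
    (Phi o s' t u * B o s' u * D o s' t)^*.
  rewrite /Y -(pair_avg (fun q u => \avg_s \avg_s' W q.1 q.2 u s s')).
  rewrite -(pair_avg (fun o t => \avg_u \avg_s \avg_s' W o t u s s')).
  apply: eq_avg => o.
  under eq_avg do rewrite exchange_avg.
  rewrite exchange_avg; apply: eq_avg => s.
  under eq_avg do rewrite exchange_avg.
  rewrite exchange_avg; apply: eq_avg => s'.
  apply: eq_avg => t; apply: eq_avg => u.
  by rewrite /W /Phi' /B' /D' /Psi /= !rmorphM; ring.
have B1' : forall p, bounded1 (B' p).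
  by move=> p u; apply: modulusM_le1; rewrite ?modulus_conj; exact: B1.
have D1' : forall p, bounded1 (D' p).
  by move=> p u; apply: modulusM_le1; rewrite ?modulus_conj; exact: D1.
have := box_cauchy_schwarz2 Phi' B1' D1'.
rewrite -(pair_avg (fun q s' => \avg_t \avg_t' \avg_u \avg_u'
  (Phi' (q, s') t u * (Phi' (q, s') t' u)^* *
   (Phi' (q, s') t u' * (Phi' (q, s') t' u')^*)^*))).
by rewrite -(pair_avg (fun o s => \avg_s' \avg_t \avg_t' \avg_u \avg_u'
  (Phi' (o, s, s') t u * (Phi' (o, s, s') t' u)^* *
   (Phi' (o, s, s') t u' * (Phi' (o, s, s') t' u')^*)^*))).
Qed.

End ComplexModulus.

(** * From quadratic to linear shifts *)
Section FiniteGroup.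
Variables (R : rcfType) (G : finComNzRingType).
Local Notation C := R[i].
Implicit Types (f F : G -> C) (h x : G).

(** Counterpart of [mul_diff] on a finite ring. *)
Definition mder h f : G -> C := fun x => f x * (f (x + h))^*.

Lemma bounded1_mder h f : bounded1 f -> bounded1 (mder h f).
Proof. by move=> f1 x; apply: modulusM_le1; rewrite ?modulus_conj. Qed.

Lemma mderC h k f : mder h (mder k f) =1 mder k (mder h f).
Proof.
move=> x; rewrite /mder !rmorphM /= !conjCK.
have -> : x + h + k = x + k + h by ring.
by ring.
Qed.

Lemma eq_mder h f F : f =1 F -> mder h f =1 mder h F.
Proof. by move=> fF x; rewrite /mder !fF. Qed.

Lemma avg_translate (K : numFieldType) h (F : G -> K) : avg F = \avg_x F (x + h).
Proof. by apply: reindex_avg; exact: addIr. Qed.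

(** When F is evaluated at a sum of three parts, one for each parameter, the cube
    of values left over by the box inequality is an iterated multiplicative
    derivative of F at its base vertex. *)
Lemma group_box_cauchy_schwarz (T1 T2 T3 : finType) F (l1 : T1 -> G) (l2 : T2 -> G)
    (l3 : T3 -> G) (A : G -> T2 -> T3 -> C) (B : G -> T1 -> T3 -> C)
    (D : G -> T1 -> T2 -> C) :
  (forall o t, bounded1 (A o t)) -> (forall o t, bounded1 (B o t)) ->
  (forall o t, bounded1 (D o t)) ->
  modulus (\avg_x \avg_s \avg_t \avg_u
     (F (x + l1 s + l2 t + l3 u) * A x t u * B x s u * D x s t)) ^+ 8
    <= complex.Re (\avg_s \avg_s' \avg_t \avg_t' \avg_u \avg_u' \avg_x
         mder (l3 u' - l3 u) (mder (l2 t' - l2 t) (mder (l1 s' - l1 s) F)) x).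
Proof.
move=> A1 B1 D1.
have := box_cauchy_schwarz3 (fun x s t u => F (x + l1 s + l2 t + l3 u)) A1 B1 D1.
set X := (X in _ <= complex.Re X -> _); set Y := (Y in _ -> _ <= complex.Re Y).
suff -> : X = Y by [].
rewrite /X /Y.
rewrite exchange_avg; apply: eq_avg => s; rewrite exchange_avg; apply: eq_avg => s'.
rewrite exchange_avg; apply: eq_avg => t; rewrite exchange_avg; apply: eq_avg => t'.
rewrite exchange_avg; apply: eq_avg => u; rewrite exchange_avg; apply: eq_avg => u'.
rewrite [RHS](avg_translate (l1 s + l2 t + l3 u)).
apply: eq_avg => y; rewrite /mder.
rewrite !rmorphM /= !conjCK.
repeat (congr (_ * _) || congr (_^*)); congr F; ring.
Qed.


(** Moving the window by one changes the sum by two terms. *)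
Lemma avg_shift_error (M t : nat) (Phi : nat -> C) : bounded1 Phi ->
  modulus (\avg_(y < M) Phi y - \avg_(y < M) Phi (y + t)%N) <= (2 * t)%:R / M%:R.
Proof.
move=> Phi1; rewrite /avg card_ord -mulrBl modulusM modulusV modulus_nat.
rewrite ler_wpM2r ?invr_ge0 ?ler0n//.
elim: t => [|t IHt].
  rewrite muln0; set a := \sum_(i < M) Phi i.
  by under [X in a - X]eq_bigr do rewrite addn0; rewrite subrr modulus0.
rewrite mulnS addnC natrD.
set a := \sum_(i < M) Phi i; set b := \sum_(i < M) Phi (i + t)%N.
have -> : a - \sum_(i < M) Phi (i + t.+1)%N =
    (a - b) - (\sum_(i < M) Phi (i + t.+1)%N - b) by ring.
apply: le_trans (modulusD _ _) _; apply: lerD => //.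
rewrite modulusN /b -sumrB.
have -> : \sum_(i < M) (Phi (i + t.+1)%N - Phi (i + t)%N) = Phi (M + t)%N - Phi t.
  rewrite -(big_mkord xpredT (fun i => Phi (i + t.+1)%N - Phi (i + t)%N)).
  under eq_bigr do rewrite addnS -addSn.
  by rewrite (telescope_sumr (fun i => Phi (i + t)%N)).
apply: le_trans (modulusD _ _) _; rewrite modulusN -[2%:R]/(1 + 1).
by rewrite lerD ?Phi1.
Qed.

(** Replacing y by y + s + t + u and x by x - z1 s - z2 t - z3 u makes F1, F2
    and F3 independent of s, t and u respectively, so the box inequality leaves
    only F0.  The average over y has become idle; the truncation at 0 absorbs
    the boundary error of the shift of y. *)
Lemma linear_forms (M H : nat) (F0 F1 F2 F3 : G -> C) (z1 z2 z3 c1 c2 c3 : G) :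
  (0 < H)%N -> bounded1 F0 -> bounded1 F1 -> bounded1 F2 -> bounded1 F3 ->
  (Num.max 0 (modulus (\avg_(y < M) \avg_x (F0 x * (F1 (x + z1 * y%:R + c1) *
      F2 (x + z2 * y%:R + c2) * F3 (x + z3 * y%:R + c3)))) - (6 * H)%:R / M%:R)) ^+ 8
  <= complex.Re (\avg_(s < H) \avg_(s' < H) \avg_(t < H) \avg_(t' < H)
        \avg_(u < H) \avg_(u' < H) \avg_x
        mder (z3 * (u%:R - u'%:R)) (mder (z2 * (t%:R - t'%:R))
          (mder (z1 * (s%:R - s'%:R)) F0)) x).
Proof.
move=> H0 b0 b1 b2 b3.
pose Psi x y := F0 x * (F1 (x + z1 * y%:R + c1) *
      F2 (x + z2 * y%:R + c2) * F3 (x + z3 * y%:R + c3)).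
rewrite -/(Psi _ _).
set W := complex.Re _.
pose l (z : G) (s : 'I_H) := - (z * s%:R).
pose A (y : nat) x (t u : 'I_H) :=
  F1 (x + z1 * (y + t + u)%:R - z2 * t%:R - z3 * u%:R + c1).
pose B (y : nat) x (s u : 'I_H) :=
  F2 (x + z2 * (y + s + u)%:R - z1 * s%:R - z3 * u%:R + c2).
pose D (y : nat) x (s t : 'I_H) :=
  F3 (x + z3 * (y + s + t)%:R - z1 * s%:R - z2 * t%:R + c3).
pose Q (y : nat) := modulus (\avg_x \avg_s \avg_t \avg_u
  (F0 (x + l z1 s + l z2 t + l z3 u) * A y x t u * B y x s u * D y x s t)).
have QW y : Q y ^+ 8 <= W.
  have := @group_box_cauchy_schwarz _ _ _ F0 (l z1) (l z2) (l z3) (A y) (B y) (D y).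
  move=> /(_ (fun _ _ _ => b1 _) (fun _ _ _ => b2 _) (fun _ _ _ => b3 _)).
  rewrite -/(Q y) => h; apply: (eq_Re_le h).
  rewrite /l.
  do 7 (apply: eq_avg => ?).
  have e (z : G) (i j : 'I_H) : - (z * j%:R) - - (z * i%:R) = z * (i%:R - j%:R).
    by ring.
  by rewrite !e.
have W0 : 0 <= W by apply: le_trans (QW 0%N); rewrite exprn_even_ge0.
have cH : (0 < #|'I_H|)%N by rewrite card_ord.
set S := avg _.
pose S' := \avg_(s < H) \avg_(t < H) \avg_(u < H) \avg_(y < M) \avg_x Psi x (y + (s + t + u))%N.
have SS' : modulus S <= (6 * H)%:R / M%:R + modulus S'.
  have -> : S = (S - S') + S' by rewrite subrK.
  apply: le_trans (modulusD _ _) _; rewrite lerD2r.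
  have -> : S - S' = \avg_(s < H) \avg_(t < H) \avg_(u < H)
      (S - \avg_(y < M) \avg_x Psi x (y + (s + t + u))%N).
    rewrite -[X in X - S'](avg_const (I := 'I_H))// -avgB; apply: eq_avg => s.
    rewrite -[X in X - _](avg_const (I := 'I_H))// -avgB; apply: eq_avg => t.
    by rewrite -[X in X - _](avg_const (I := 'I_H))// -avgB; apply: eq_avg => u.
  have e0 : 0 <= (6 * H)%:R / M%:R :> R by rewrite divr_ge0 ?ler0n.
  apply: le_trans (modulus_avg _) _; apply: ler_avg_const => // s.
  apply: le_trans (modulus_avg _) _; apply: ler_avg_const => // t.
  apply: le_trans (modulus_avg _) _; apply: ler_avg_const => // u.
  rewrite /S.
  apply: le_trans (@avg_shift_error M _ (fun y => \avg_x Psi x y) _) _.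
    move=> y; apply: bounded1_avg => x.
    by do ! apply: modulusM_le1.
  rewrite ler_wpM2r ?invr_ge0 ?ler0n// ler_nat.
  by move: (ltn_ord s) (ltn_ord t) (ltn_ord u); lia.
have S'Q : modulus S' <= \avg_(y < M) Q y.
  apply: le_trans (modulus_avg _); rewrite le_eqVlt; apply/orP; left; apply/eqP.
  congr modulus; rewrite /S'.
  transitivity (\avg_(s < H) \avg_(t < H) \avg_(u < H) \avg_(y < M) \avg_x
    (F0 (x + l z1 s + l z2 t + l z3 u) * A y x t u * B y x s u * D y x s t)).
    apply: eq_avg => s; apply: eq_avg => t; apply: eq_avg => u; apply: eq_avg => y.
    rewrite (avg_translate (l z1 s + l z2 t + l z3 u)); apply: eq_avg => x.
    by rewrite /Psi /A /B /D /l !mulrA; do ! congr (_ * _);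
      [congr F0|congr F1|congr F2|congr F3]; ring.
  under eq_avg do under eq_avg do rewrite exchange_avg.
  under eq_avg do rewrite exchange_avg.
  rewrite exchange_avg; apply: eq_avg => y.
  under eq_avg do under eq_avg do rewrite exchange_avg.
  under eq_avg do rewrite exchange_avg.
  by rewrite exchange_avg.
have Q0 y : 0 <= Q y by exact: modulus_ge0.
apply: (le_trans (y := (\avg_(y < M) Q y) ^+ 8)).
  apply: ler_expr_nonneg; first by rewrite le_max lexx.
  rewrite ge_max avg_ge0//= lerBlDl; apply: le_trans SS' _.
  by rewrite lerD2l.
apply: le_trans (avg_pow2_le 3 _) _; first by move=> y; exact: Q0.
by apply: ler_avg_const => // y; exact: QW.
Qed.

(** With y replaced by y + a + b and x by x - o b, the weight g0 is evaluated at
    x - o b and g1 at x + o (y + a + 1), so each misses one of a and b.  The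
    right-hand side is recorded with the base vertex of each parallelogram
    translated to x: the three other arguments are then linear in y, the
    quadratic terms being confined to the constants. *)
Lemma quadratic_box (M H : nat) (g0 g1 f : G -> C) (o q : G) :
  (0 < H)%N -> bounded1 g0 -> bounded1 g1 -> bounded1 f ->
  (Num.max 0 (modulus (\avg_(y < M) \avg_x (g0 x * g1 (x + o * y.+1%:R) *
      f (x + q * y.+1%:R ^+ 2))) - (4 * H)%:R / M%:R)) ^+ 4
  <= complex.Re (\avg_(a < H) \avg_(a' < H) \avg_(b < H) \avg_(b' < H)
       \avg_(y < M) \avg_x (f x *
        ((f (x + q * 2 * (b'%:R - b%:R) * y%:R +
             (q * (b'%:R - b%:R) * (2 + 2 * a%:R + b%:R + b'%:R) - o * (b'%:R - b%:R))))^* *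
         (f (x + q * 2 * (a'%:R - a%:R) * y%:R +
              q * (a'%:R - a%:R) * (2 + a%:R + a'%:R + 2 * b%:R)))^* *
          f (x + q * 2 * (a'%:R - a%:R + (b'%:R - b%:R)) * y%:R +
             (q * (a'%:R - a%:R + (b'%:R - b%:R)) * (2 + a%:R + a'%:R + b%:R + b'%:R)
               - o * (b'%:R - b%:R)))))).
Proof.
move=> H0 b0 b1 bf.
pose Psi x (y : nat) := g0 x * g1 (x + o * y.+1%:R) * f (x + q * y.+1%:R ^+ 2).
rewrite -/(Psi _ _).
set W := complex.Re _.
have cH : (0 < #|'I_H|)%N by rewrite card_ord.
pose Phi (p : 'I_M * G) (a b : 'I_H) :=
  f (p.2 - o * b%:R + q * (p.1 + a + b).+1%:R ^+ 2).
pose A (p : 'I_M * G) (b : 'I_H) := g0 (p.2 - o * b%:R).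
pose B (p : 'I_M * G) (a : 'I_H) := g1 (p.2 + o * (p.1 + a).+1%:R).
set S := avg _.
pose S' := \avg_(a < H) \avg_(b < H) \avg_(y < M) \avg_x Psi x (y + (a + b))%N.
have SS' : modulus S <= (4 * H)%:R / M%:R + modulus S'.
  have -> : S = (S - S') + S' by rewrite subrK.
  apply: le_trans (modulusD _ _) _; rewrite lerD2r.
  have -> : S - S' = \avg_(a < H) \avg_(b < H)
      (S - \avg_(y < M) \avg_x Psi x (y + (a + b))%N).
    rewrite -[X in X - S'](avg_const (I := 'I_H))// -avgB; apply: eq_avg => s.
    by rewrite -[X in X - _](avg_const (I := 'I_H))// -avgB; apply: eq_avg => t.
  have e0 : 0 <= (4 * H)%:R / M%:R :> R by rewrite divr_ge0 ?ler0n.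
  apply: le_trans (modulus_avg _) _; apply: ler_avg_const => // s.
  apply: le_trans (modulus_avg _) _; apply: ler_avg_const => // t.
  rewrite /S.
  apply: le_trans (@avg_shift_error M _ (fun y => \avg_x Psi x y) _) _.
    move=> y; apply: bounded1_avg => x.
    by do ! apply: modulusM_le1.
  rewrite ler_wpM2r ?invr_ge0 ?ler0n// ler_nat.
  by move: (ltn_ord s) (ltn_ord t); lia.
have -> : W = complex.Re (\avg_p \avg_a \avg_a' \avg_b \avg_b'
   (Phi p a b * (Phi p a' b)^* * (Phi p a b' * (Phi p a' b')^*)^*)).
  apply: (congr1 (@complex.Re R)).
  rewrite exchange_avg; apply: eq_avg => a; rewrite exchange_avg; apply: eq_avg => a'.
  rewrite exchange_avg; apply: eq_avg => b; rewrite exchange_avg; apply: eq_avg => b'.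
  rewrite -(pair_avg (fun y x => Phi (y, x) a b * (Phi (y, x) a' b)^* *
    (Phi (y, x) a b' * (Phi (y, x) a' b')^*)^*)).
  apply: eq_avg => y.
  rewrite [RHS](avg_translate (o * b%:R - q * (y + a + b).+1%:R ^+ 2)).
  apply: eq_avg => x; rewrite /Phi /=.
  have -> z1 z2 z3 z4 : z1 * (z2^* * z3^* * z4) = z1 * z3^* * (z2 * z4^*)^* :> C.
    by rewrite rmorphM /= conjCK; ring.
  repeat (congr (_ * _) || congr (_^*)); congr f; ring.
have S'E : S' = \avg_p \avg_a \avg_b (Phi p a b * A p b * B p a).
  rewrite [RHS]exchange_avg; apply: eq_avg => a.
  rewrite [RHS]exchange_avg; apply: eq_avg => b.
  rewrite -(pair_avg (fun y x => Phi (y, x) a b * A (y, x) b * B (y, x) a)).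
  apply: eq_avg => y; rewrite (avg_translate (- o * b%:R)).
  apply: eq_avg => x; rewrite /Psi /A /B /Phi /=.
  rewrite -[RHS]mulrA [RHS]mulrC.
  repeat congr (_ * _); [congr g0|congr g1|congr f]; ring.
have Ab p : bounded1 (A p) by move=> b; exact: b0.
have Bb p : bounded1 (B p) by move=> b; exact: b1.
apply: le_trans (box_cauchy_schwarz2 Phi Ab Bb).
apply: ler_expr_nonneg; first by rewrite le_max lexx.
by rewrite ge_max modulus_ge0 lerBlDl -S'E.
Qed.

(** The constants that depend on a, a', b, b' are harmless in [linear_forms],
    which is applied for each value of these four parameters. *)
Lemma linearisation (M H : nat) (g0 g1 f : G -> C) (o q : G) :
  (0 < H)%N -> bounded1 g0 -> bounded1 g1 -> bounded1 f ->
  (Num.max 0 ((Num.max 0 (modulus (\avg_(y < M) \avg_x (g0 x * g1 (x + o * y.+1%:R) *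
      f (x + q * y.+1%:R ^+ 2))) - (4 * H)%:R / M%:R)) ^+ 4 - (6 * H)%:R / M%:R)) ^+ 8
  <= \avg_(a < H) \avg_(b < H) \avg_(b' < H) \avg_(s < H) \avg_(s' < H)
     \avg_(t' < H) \avg_(u' < H) modulus (\avg_(a' < H) \avg_(t < H) \avg_(u < H) \avg_x
        mder (q * 2 * (a'%:R - a%:R + (b'%:R - b%:R)) * (u%:R - u'%:R))
          (mder (q * 2 * (a'%:R - a%:R) * (t%:R - t'%:R))
            (mder (q * 2 * (b'%:R - b%:R) * (s%:R - s'%:R)) f)) x).
Proof.
move=> H0 b0 b1 bf.
have /le_trans/(_ (Re_modulus _)) := quadratic_box M o q H0 b0 b1 bf.
set P := (_ ^+ 4); set T := avg _ => PT.
have bfc z : bounded1 (fun x => (f (x + z))^*) by move=> x; rewrite modulus_conj.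
have bfc' : bounded1 (fun x => (f x)^*) by move=> x; rewrite modulus_conj.
pose E := (6 * H)%:R / M%:R : R.
pose V (a a' b b' : 'I_H) : R := \avg_(s < H) complex.Re (\avg_(s' < H) \avg_(t < H)
  \avg_(t' < H) \avg_(u < H) \avg_(u' < H) \avg_x
        mder (q * 2 * (a'%:R - a%:R + (b'%:R - b%:R)) * (u%:R - u'%:R))
          (mder (q * 2 * (a'%:R - a%:R) * (t%:R - t'%:R))
            (mder (q * 2 * (b'%:R - b%:R) * (s%:R - s'%:R)) f)) x).
have step (I : finType) (F : I -> C) (v : I -> R) : (0 < #|I|)%N ->
    (forall i, Num.max 0 (modulus (F i) - E) ^+ 8 <= v i) ->
    Num.max 0 (modulus (avg F) - E) ^+ 8 <= avg v.
  move=> I0 Fv; apply: (le_trans (y := (\avg_i Num.max 0 (modulus (F i) - E)) ^+ 8)).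
    apply: ler_expr_nonneg; first by rewrite le_max lexx.
    rewrite ge_max avg_ge0//=; last by move=> i; rewrite le_max lexx.
    rewrite -[X in _ - X](avg_const (I := I))// lerBlDr -avgD.
    apply: le_trans (modulus_avg _) _; apply: ler_avg => i.
    by rewrite -lerBlDr le_max lexx orbT.
  apply: le_trans (avg_pow2_le 3 _) _; first by move=> i; rewrite le_max lexx.
  by apply: ler_avg => i; exact: Fv.
have cH : (0 < #|'I_H|)%N by rewrite card_ord.
apply: (le_trans (y := \avg_a \avg_a' \avg_b \avg_b' V a a' b b')).
  apply: (le_trans (y := Num.max 0 (modulus T - E) ^+ 8)).
    apply: ler_expr_nonneg; first by rewrite le_max lexx.
    by rewrite ge_max !le_max lexx /= lerB ?orbT.
  do 4 (apply: (step) => // ?).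
  rewrite /V -Re_avg.
  exact: (@linear_forms M H f (fun x => (f x)^*) (fun x => (f x)^*) f).
under eq_avg do (rewrite exchange_avg; under eq_avg do rewrite exchange_avg).
apply: ler_avg => a; apply: ler_avg => b; apply: ler_avg => b'.
rewrite exchange_avg; apply: ler_avg => s.
under eq_avg do rewrite Re_avg; rewrite exchange_avg; apply: ler_avg => s'.
under eq_avg do rewrite exchange_avg Re_avg; rewrite exchange_avg; apply: ler_avg => t'.
under eq_avg do under eq_avg do rewrite exchange_avg.
under eq_avg do rewrite exchange_avg Re_avg; rewrite exchange_avg; apply: ler_avg => u'.
by rewrite -Re_avg; exact: Re_modulus.
Qed.
End FiniteGroup.

(** * Values of binary linear forms *)
Section Counting.

(** The pairs (a, b) for which a s + b u, with s, u < n, may take some value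
    more than K^2 times; nothing has to be excluded when n <= K. *)
Definition degenerate (n K : nat) (a b : int) : bool :=
  (K < n)%N && ((K * `|b| < n)%N || (K < gcdn `|a| `|b|)%N).

Definition solutions (n : nat) (a b k : int) : {set 'I_n * 'I_n} :=
  [set p : 'I_n * 'I_n | a * (p.1 : nat)%:Z + b * (p.2 : nat)%:Z == k].

Definition degenerate_pairs (n K : nat) (a b : int) : {set 'I_n * 'I_n} :=
  [set p : 'I_n * 'I_n | degenerate n K (a + (p.1 : nat)%:Z) (b + (p.2 : nat)%:Z)].

(** Suppose n > K.  On solutions of a s + b u = k the residue of s modulo
    c = |b| / gcd(a, b) is constant and s determines u, so a solution is
    determined by the quotient of s by c; there are at most n / c <= K^2
    quotients. *)
Lemma few_solutions (n K : nat) (a b k : int) : ~~ degenerate n K a b ->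
  (#|solutions n a b k| <= K ^ 2)%N.
Proof.
rewrite /degenerate negb_and -leqNgt => /orP[nK|].
  apply: leq_trans (max_card _) _.
  by rewrite card_prod !card_ord -mulnn leq_mul.
rewrite negb_or -!leqNgt => /andP[nKb gK].
have [->|n0] := posnP n.
  by rewrite (leq_trans (max_card _))// card_prod card_ord.
have b0 : (0 < `|b|)%N by rewrite lt0n; apply: contraTneq nKb => ->; rewrite muln0 -ltnNge.
pose g := gcdn `|a| `|b|; pose c := (`|b| %/ g)%N.
have g0 : (0 < g)%N by rewrite gcdn_gt0 b0 orbT.
have bE : `|b|%N = (c * g)%N by rewrite divnK// dvdn_gcdr.
have c0 : (0 < c)%N by move: b0; rewrite bE muln_gt0 => /andP[].
have nc : (n <= K ^ 2 * c)%N.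
  apply: leq_trans nKb _; rewrite bE [(c * g)%N]mulnC mulnA -mulnn.
  by rewrite leq_mul2r leq_mul2l gK !orbT.
have lt_q (s : 'I_n) : (s %/ c < K ^ 2)%N.
  by rewrite ltn_divLR// (leq_trans (ltn_ord s)).
pose h (p : 'I_n * 'I_n) : 'I_(K ^ 2) := Ordinal (lt_q p.1).
rewrite -[leqRHS]card_ord; apply: (@leq_card_in _ _ h).
move=> [s u] [s' u']; rewrite !inE /= => /eqP e1 /eqP e2 /(congr1 val)/= ess.
have e : a * ((s : nat)%:Z - (s' : nat)%:Z) = b * ((u' : nat)%:Z - (u : nat)%:Z).
  by apply/eqP; rewrite -subr_eq0; apply/eqP; move: e1 e2; lia.
have dv : (c %| `|(s : nat)%:Z - (s' : nat)%:Z|)%N.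
  have cop : coprime c (`|a| %/ g).
    by rewrite /coprime -(eqn_pmul2r g0) muln_gcdl -bE divnK ?dvdn_gcdl// mul1n gcdnC.
  rewrite -(Gauss_dvdr _ cop) -(dvdn_pmul2r g0) -bE mulnAC divnK ?dvdn_gcdl//.
  by rewrite -abszM e abszM dvdn_mulr.
have ss : s = s' :> nat.
  have := divn_eq s c; have := divn_eq s' c; rewrite ess.
  have := ltn_pmod s c0; have := ltn_pmod s' c0.
  move: dv => /dvdnP[w]; case: w => [|w]; first by lia.
  by rewrite mulSn; set x := (_ * c)%N; lia.
have : b * ((u' : nat)%:Z - (u : nat)%:Z) = 0 by rewrite -e ss subrr mulr0.
move=> /eqP; rewrite mulf_eq0 -absz_eq0 -[_ == 0%N]negbK -lt0n b0 /=.
by rewrite subr_eq0 => /eqP[uu]; congr (_, _); apply: val_inj.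
Qed.

Lemma card_multiples (n g : nat) (a : int) : (0 < g)%N ->
  (#|[set i : 'I_n | (g %| `|(a + (i : nat)%:Z)%R|)%N]| <= (n %/ g).+1)%N.
Proof.
move=> g0; have lt_q (s : 'I_n) : (s %/ g < (n %/ g).+1)%N.
  by rewrite ltnS leq_div2r// ltnW.
rewrite -[leqRHS]card_ord; apply: (@leq_card_in _ _ (fun s => Ordinal (lt_q s))).
move=> s s'; rewrite !inE => d1 d2 /(congr1 val)/= ess; apply: val_inj => /=.
have dv : (g %| `|(s : nat)%:Z - (s' : nat)%:Z|)%N.
  have -> : (s : nat)%:Z - (s' : nat)%:Z = (a + (s : nat)%:Z) - (a + (s' : nat)%:Z) by lia.
  have toZ (m : int) : (g %| `|m|)%N = (g%:Z %| m)%Z by rewrite dvdzE.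
  by move: d1 d2; rewrite !toZ => d1 d2; rewrite rpredB.
have := divn_eq s g; have := divn_eq s' g; rewrite ess.
have := ltn_pmod s g0; have := ltn_pmod s' g0.
move: dv => /dvdnP[w]; case: w => [|w]; first by lia.
by rewrite mulSn; set x := (_ * g)%N; lia.
Qed.

Lemma card_near_zero (n K : nat) (b : int) : (K < n)%N ->
  (K * #|[set j : 'I_n | (K * `|(b + (j : nat)%:Z)%R| < n)%N]| <= 3 * n)%N.
Proof.
move=> Kn; have [->//|K0] := posnP K.
pose m := (n.-1 %/ K)%N.
have mK : (K * m < n)%N by have := leq_trunc_div n.-1 K; rewrite -/m; lia.
suff : (#|[set j : 'I_n | (K * `|(b + (j : nat)%:Z)%R| < n)%N]| <= m.*2.+1)%N.
  by move=> h; apply: leq_trans (leq_mul (leqnn K) h) _; lia.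
pose h (j : 'I_n) : 'I_m.*2.+1 := inord `|(b + (j : nat)%:Z + m%:Z)%R|.
have inS (j : 'I_n) : (K * `|(b + (j : nat)%:Z)%R| < n)%N -> (`|(b + (j : nat)%:Z)%R| <= m)%N.
  by move=> hj; rewrite leq_divRL// mulnC; lia.
rewrite -[leqRHS]card_ord; apply: (@leq_card_in _ _ h).
move=> s s'; rewrite !inE => /inS d1 /inS d2 /(congr1 val).
by rewrite /= !inordK; [move=> e; apply: val_inj => /=|..]; lia.
Qed.

(** The condition on |b| excludes at most 3 n^2 / K pairs.  A common factor g occurs
    for at most (3 n / g)^2 pairs, and summing 1 / g^2 over g > K gives 1 / K by
    comparison with a telescoping series. *)
Lemma card_degenerate (n K : nat) (a b : int) : (`|b| <= n)%N ->
  (K * #|degenerate_pairs n K a b| <= 12 * n ^ 2)%N.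
Proof.
move=> bn; have [nK|Kn] := leqP n K.
  rewrite (_ : degenerate_pairs _ _ _ _ = finset.set0) ?cards0 ?muln0//.
  by apply/setP => p; rewrite !inE /degenerate ltnNge nK.
have [->//|K0] := posnP K.
pose X g := [set i : 'I_n | (g %| `|(a + (i : nat)%:Z)%R|)%N].
pose Y g := [set i : 'I_n | (g %| `|(b + (i : nat)%:Z)%R|)%N].
pose Z := [set j : 'I_n | (K * `|(b + (j : nat)%:Z)%R| < n)%N].
set S := degenerate_pairs _ _ _ _.
have subS : S \subset finset.setX [set: 'I_n] Z :|:
    \bigcup_(g < (2 * n).+1 | (K < g)%N) finset.setX (X g) (Y g).
  apply/fintype.subsetP => -[i j]; rewrite !inE /degenerate Kn /=.
  case: ltnP => //= nKj Kg; apply/finset.bigcupP.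
  have bj0 : (0 < `|(b + (j : nat)%:Z)%R|)%N.
    by rewrite lt0n; apply: contraTneq nKj => ->; rewrite muln0 -ltnNge; lia.
  have le_g : (gcdn `|(a + (i : nat)%:Z)%R| `|(b + (j : nat)%:Z)%R| <= 2 * n)%N.
    apply: leq_trans (dvdn_leq bj0 (dvdn_gcdr _ _)) _.
    by move: (ltn_ord j); lia.
  exists (inord (gcdn `|(a + (i : nat)%:Z)%R| `|(b + (j : nat)%:Z)%R|)); first by rewrite inordK ?ltnS.
  by rewrite !inE /= inordK ?ltnS// dvdn_gcdl dvdn_gcdr.
have cardS : (#|S| <= n * #|Z| + \sum_(g < (2 * n).+1 | (K < g)%N) #|X g| * #|Y g|)%N.
  apply: leq_trans (subset_leq_card subS) _.
  apply: leq_trans (leq_card_setU _ _) _.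
  rewrite cardsX cardsT card_ord leq_add2l.
  elim/big_rec2: _ => [|g m U _ IH]; first by rewrite cards0.
  by apply: leq_trans (leq_card_setU _ _) _; rewrite cardsX leq_add2l.
have le_sum : (K * (\sum_(g < (2 * n).+1 | (K < g)%N) #|X g| * #|Y g|) <= 9 * n ^ 2)%N.
  have xy (g : 'I_(2 * n).+1) : (K < g)%N -> (g ^ 2 * (#|X g| * #|Y g|) <= 9 * n ^ 2)%N.
    move=> Kg; have g0 : (0 < g)%N by lia.
    have h c : (g * #|[set i : 'I_n | (g %| `|(c + (i : nat)%:Z)%R|)%N]| <= 3 * n)%N.
      apply: leq_trans (leq_mul (leqnn g) (card_multiples _ _ g0)) _.
      by have := leq_trunc_div n g; move: (ltn_ord g); lia.
    have -> : (g ^ 2 * (#|X g| * #|Y g|) = (g * #|X g|) * (g * #|Y g|))%N by lia.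
    by apply: leq_trans (leq_mul (h a) (h b)) _; lia.
  rewrite -(ler_nat rat) natrM natr_sum.
  pose u m : rat := m%:R^-1.
  apply: (le_trans (y := K%:R * (\sum_(g < (2 * n).+1 | (K < g)%N)
     (9 * n ^ 2)%:R * (u g.-1 - u g)))).
    rewrite ler_pM2l ?ltr0n//; apply: ler_sum => g Kg.
    have g0 : 0 < (g : nat)%:R :> rat by rewrite ltr0n; lia.
    have g1 : 0 < (g.-1)%:R :> rat by rewrite ltr0n; lia.
    have gE : (g : nat)%:R = (g.-1)%:R + 1 :> rat by rewrite natr1 prednK//; lia.
    apply: (le_trans (y := (9 * n ^ 2)%:R / (g : nat)%:R ^+ 2)).
      by rewrite ler_pdivlMr ?exprn_gt0// mulrC -natrX -natrM ler_nat xy.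
    rewrite ler_wpM2l ?ler0n// /u gE.
    rewrite -subr_ge0; set v := (g.-1)%:R in g1 *.
    have -> : v^-1 - (v + 1)^-1 - (v + 1) ^- 2 = v^-1 * (v + 1) ^- 2.
      by field; rewrite !gt_eqF// addr_gt0.
    by rewrite mulr_ge0 ?invr_ge0 ?exprn_ge0 ?addr_ge0// ltW.
  rewrite -mulr_sumr mulrCA ler_piMr ?ler0n//.
  rewrite -(big_mkord (fun g => K < g)%N (fun g => u g.-1 - u g)).
  rewrite (big_cat_nat (n := K.+1)) //=; last by lia.
  rewrite big_nat_cond big_pred0 ?add0r; last by move=> i; lia.
  have -> : \sum_(K.+1 <= g < (2 * n).+1 | (K < g)%N) (u g.-1 - u g) = u K - u (2 * n)%N.
    transitivity (\sum_(K.+1 <= g < (2 * n).+1) (u g.-1 - u g)).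
      by rewrite big_nat_cond [RHS]big_nat_cond; apply: eq_bigl => i; lia.
    rewrite big_add1 /= -[LHS]opprK -sumrN.
    under eq_bigr do rewrite opprB.
    by rewrite telescope_sumr ?opprB//; lia.
  rewrite mulrBr divff ?pnatr_eq0 -?lt0n//.
  by rewrite gerBl mulr_ge0 ?invr_ge0 ?ler0n.
have := card_near_zero b Kn; rewrite -/Z => hZ.
have := leq_mul (leqnn n) hZ; have := leq_mul (leqnn K) cardS.
by move: le_sum; rewrite !mulnDr; nia.
Qed.

End Counting.

(** * Making sparse directions dense *)
Section Pushforward.
Variable R : realFieldType.
Implicit Types (I : finType) (F : int -> R).

Definition avg_sym (n : nat) F : R := \avg_(k < 2 * n) F ((k : nat)%:Z - n%:Z).

Lemma avg_sym_ge0 n F : (forall k, 0 <= F k) -> 0 <= avg_sym n F.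
Proof. by move=> F0; exact: avg_ge0. Qed.

Lemma ler_avg_sym n F F' : (forall k, F k <= F' k) -> avg_sym n F <= avg_sym n F'.
Proof. by move=> FF; exact: ler_avg. Qed.

Lemma eq_avg_sym n F F' : F =1 F' -> avg_sym n F = avg_sym n F'.
Proof. by move=> FF; exact: eq_avg. Qed.

Lemma exchange_avg_sym n m (F : int -> int -> R) :
  avg_sym n (fun k => avg_sym m (F k)) = avg_sym m (fun l => avg_sym n (F^~ l)).
Proof. exact: exchange_avg. Qed.

(** The mechanism by which a sparse family of shifts is replaced by a full
    interval: it is enough that phi has small fibres. *)
Lemma avg_pushforward I (phi : I -> int) (n m : nat) F :
  (forall k, 0 <= F k) -> (forall i, - n%:Z <= phi i < n%:Z) ->
  (forall k, (#|[set i | phi i == k]| <= m)%N) ->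
  \avg_i F (phi i) <= m%:R * (2 * n)%:R / #|I|%:R * avg_sym n F.
Proof.
move=> F0 phin fib; have [n0|n0] := posnP n.
  rewrite n0 !muln0 !(mulr0, mul0r) /avg.
  rewrite big_pred0 ?mul0r// => i; have := phin i; rewrite n0; lia.
have lt_p i : (`|(phi i + n%:Z)%R| < 2 * n)%N by have := phin i; lia.
pose p i := Ordinal (lt_p i).
have pE i : ((p i : nat)%:Z - n%:Z) = phi i by have := phin i; rewrite /=; lia.
rewrite /avg_sym /avg card_ord; set S := \sum_(k < 2 * n) _.
have nn : (2 * n)%:R != 0 :> R by rewrite pnatr_eq0; lia.
have e (a b c d : R) : b != 0 -> c * b * a * (d / b) = c * d * a by move=> b0; field.
rewrite e//.
rewrite ler_wpM2r ?invr_ge0 ?ler0n// (partition_big p xpredT)//= mulr_sumr.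
apply: ler_sum => k _.
rewrite (eq_bigr (fun=> F ((k : nat)%:Z - n%:Z))); last first.
  by move=> i /eqP <-; rewrite pE.
rewrite sumr_const -[X in X <= _]mulr_natl ler_wpM2r// ler_nat.
apply: leq_trans (fib ((k : nat)%:Z - n%:Z)); apply: subset_leq_card.
by apply/fintype.subsetP => i; rewrite !inE => /eqP <-; rewrite pE.
Qed.
End Pushforward.

Section Concatenation.
Variables (R : rcfType) (G : finComNzRingType).
Local Notation C := R[i].
Implicit Types (P E : G -> C).

Lemma avg_outside (I : finType) (B : {set I}) (F g : I -> R) (rho : R) :
  0 <= rho -> #|B|%:R <= rho * #|I|%:R -> (forall i, F i <= 1) ->
  (forall i, 0 <= g i) -> (forall i, i \notin B -> F i <= g i) ->
  avg F <= rho + avg g.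
Proof.
move=> rho0 Brho F1 g0 Fg; have [I0|I0] := posnP #|I|.
  by rewrite /avg I0 invr0 !mulr0 addr0.
apply: (le_trans (y := \avg_i ((i \in B)%:R + g i))).
  apply: ler_avg => i; case: (boolP (i \in B)) => [_|/Fg]; last by rewrite add0r.
  by apply: le_trans (F1 i) _; rewrite lerDl.
rewrite avgD lerD2r /avg -natr_sum ler_pdivrMr ?ltr0n//.
by apply: le_trans Brho; rewrite ler_nat -sum1_card [leqRHS]big_mkcond.
Qed.

Definition phase (z : C) : C := if z == 0 then 1 else z^* / `|z|.

Lemma modulus_phase z : modulus (phase z) = 1.
Proof.
rewrite /phase; case: eqP => [_|/eqP z0]; first exact: modulus1.
apply: complexI; rewrite modulusM modulus_conj modulusV rmorphM fmorphV /= !modulusE.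
by rewrite normr_id divff ?normr_eq0.
Qed.

Lemma phaseE z : phase z * z = (modulus z)%:C%C.
Proof.
rewrite /phase modulusE; case: eqP => [->|/eqP z0]; first by rewrite mulr0 normr0.
by rewrite mulrAC [_^* * z]mulrC -normCK expr2 mulfK// normr_eq0.
Qed.

Lemma avg_realC (I : finType) (F : I -> R) :
  \avg_i (F i)%:C%C = (avg F)%:C%C :> C.
Proof. by rewrite /avg rmorphM fmorphV rmorph_nat rmorph_sum. Qed.

Definition autocorr P (h : G) : R := modulus (\avg_x mder h P x).

Lemma autocorr_ge0 P h : 0 <= autocorr P h.
Proof. exact: modulus_ge0. Qed.

Lemma autocorr_le1 P h : bounded1 P -> autocorr P h <= 1.
Proof. by move=> P1; apply: bounded1_avg; exact: bounded1_mder. Qed.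

(** Insert phases, drop the factor P(x) and double (m, h): the shifts become
    m h - m' h', and for nondegenerate (m, m') each value occurs for at most K^2
    pairs (h, h'), out of about n^2, so that the average over (h, h') is
    dominated by the average over an interval of length O(n^2).  Degenerate
    pairs contribute at most their density 12 / K. *)
Lemma bilinear_concatenation (P : G -> C) (r : G) (n K : nat) :
  bounded1 P -> (0 < n)%N -> (0 < K)%N ->
  (avg_sym n (fun m => avg_sym n (fun h => autocorr P (r * (m * h)%:~R)))) ^+ 2
  <= 12 / K%:R + 2 * K%:R ^+ 2 * avg_sym (4 * n ^ 2) (fun k => autocorr P (r * k%:~R)).
Proof.
move=> P1 n0 K0.
pose N := (2 * n)%N; pose T : finType := ('I_N * 'I_N)%type.
pose v (i : 'I_N) := (i : nat)%:Z - n%:Z.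
pose ph (p : T) := v p.1 * v p.2.
pose z (p : T) := \avg_x mder (r * (ph p)%:~R) P x.
have cN : (0 < #|'I_N|)%N by rewrite card_ord /N; lia.
set S := avg_sym _ _.
have SE : S%:C%C = \avg_x \avg_p (P x * (phase (z p) * (P (x + r * (ph p)%:~R))^*)).
  rewrite [RHS]exchange_avg /S /avg_sym [X in X%:C%C]pair_avg -avg_realC.
  apply: eq_avg => p.
  rewrite /autocorr -phaseE -avgZl; apply: eq_avg => x.
  by rewrite /mder mulrCA.
have S0 : 0 <= S by do 2 (apply: avg_sym_ge0 => ?); exact: autocorr_ge0.
have <- : modulus S%:C%C = S by rewrite modulus_real ger0_norm.
rewrite SE; apply: le_trans (drop_bounded_factor _ P1) _.
apply: (le_trans (y := \avg_(q : 'I_N * 'I_N) \avg_(p : 'I_N * 'I_N)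
    autocorr P (r * (- v q.1 * v p.1 + v q.2 * v p.2)%:~R))).
  rewrite exchange_avg; under eq_avg do rewrite exchange_avg.
  apply: le_trans (Re_modulus _) _; apply: le_trans (modulus_avg _) _.
  apply: (le_trans (y := \avg_(p : T) \avg_(p' : T) autocorr P (r * (ph p - ph p')%:~R))).
    apply: ler_avg => p; apply: le_trans (modulus_avg _) _; apply: ler_avg => p'.
    rewrite le_eqVlt; apply/orP; left; apply/eqP.
    rewrite -[autocorr _ _]mul1r -(modulus_phase (z p)) -[modulus (phase _)]mulr1.
    rewrite -{1}(modulus_phase (z p')) -(modulus_conj (phase (z p'))) -!modulusM -avgZl.
    congr modulus; rewrite [RHS](avg_translate (r * (ph p')%:~R)); apply: eq_avg => x.
    have -> : x + r * (ph p)%:~R = x + r * (ph p')%:~R + r * (ph p - ph p')%:~R by ring.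
    by rewrite /mder !rmorphM /= conjCK; ring.
  rewrite le_eqVlt; apply/orP; left; apply/eqP.
  pose c i j i' j' := autocorr P (r * (- v i' * v j' + v i * v j)%:~R).
  transitivity (\avg_i \avg_j \avg_i' \avg_j' c i j i' j').
    rewrite -(pair_avg (fun i j => \avg_(p' : T) autocorr P (r * (v i * v j - ph p')%:~R))).
    apply: eq_avg => i; apply: eq_avg => j.
    rewrite -(pair_avg (fun i' j' => autocorr P (r * (v i * v j - ph (i', j'))%:~R))).
    apply: eq_avg => i'; apply: eq_avg => j'.
    by rewrite /c /ph /=; congr (autocorr P _); ring.
  rewrite -(pair_avg (fun i' i => \avg_(p : T) c i p.2 i' p.1)).
  under eq_avg do rewrite exchange_avg.
  rewrite exchange_avg; apply: eq_avg => i'; apply: eq_avg => i.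
  by rewrite exchange_avg (pair_avg (fun j' j => c i j i' j')).
pose B := degenerate_pairs N K (- n%:Z) (- n%:Z).
pose g (q : 'I_N * 'I_N) : R := 2 * K%:R ^+ 2 * avg_sym (4 * n ^ 2) (fun k => autocorr P (r * k%:~R)).
have A0 : 0 <= avg_sym (4 * n ^ 2) (fun k => autocorr P (r * k%:~R)).
  by apply: avg_sym_ge0 => k; exact: autocorr_ge0.
have g0 q : 0 <= g q by apply: mulr_ge0 => //; apply: mulr_ge0 => //; rewrite exprn_ge0 ?ler0n.
apply: (le_trans (@avg_outside _ B _ g (12 / K%:R) _ _ _ g0 _)).
- by rewrite divr_ge0 ?ler0n.
- have := card_degenerate K (- n%:Z) (b := - n%:Z) (n := N) ltac:(rewrite /N; lia).
  rewrite -/B card_prod card_ord mulrAC ler_pdivlMr ?ltr0n// -natrM -natrM ler_nat.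
  by rewrite mulnC mulnn.
- by move=> q; apply: ler_avg_const => // p; exact: autocorr_le1.
- move=> q; rewrite inE.
  have -> : degenerate N K (- n%:Z + (q.1 : nat)%:Z) (- n%:Z + (q.2 : nat)%:Z) =
      degenerate N K (- v q.1) (v q.2).
    by rewrite /degenerate abszN /v ![- n%:Z + _]addrC.
  move=> nd; set a := - v q.1 in nd *; set b := v q.2 in nd *.
  apply: le_trans (@avg_pushforward _ _ (fun p : 'I_N * 'I_N => a * v p.1 + b * v p.2)
    (4 * n ^ 2) (K ^ 2) (fun k => autocorr P (r * k%:~R)) _ _ _) _.
  + by move=> k; exact: autocorr_ge0.
  + have bv (i : 'I_N) : - n%:Z <= v i < n%:Z by rewrite /v; move: (ltn_ord i); rewrite /N; lia.
    move=> p; rewrite /a /b; move: (bv q.1) (bv q.2) (bv p.1) (bv p.2) n0.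
    move: (v _) (v _) (v _) (v _) => x1 x2 x3 x4; nia.
  + move=> k; apply: leq_trans (few_solutions (k + a * n%:Z + b * n%:Z) nd).
    apply: subset_leq_card; apply/fintype.subsetP => p; rewrite !inE /v => /eqP <-.
    by apply/eqP; ring.
  + rewrite /g ler_wpM2r// card_prod card_ord /N -!mulnn !natrM.
    have n1 : n%:R != 0 :> R by rewrite pnatr_eq0; lia.
    by rewrite le_eqVlt; apply/orP; left; apply/eqP; field.
by rewrite lerD2l avg_const// card_prod card_ord muln_gt0 /N; lia.
Qed.
End Concatenation.

(** * The box with dependent directions *)
Section PairedBox.
Variables (R : rcfType) (G : finComNzRingType).
Local Notation C := R[i].

(** Cut-off that lets a parameter ranging over H values absorb any shift t <= 2 H:
    the range is enlarged to 3 H values and the cut-off, a function of the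
    shifted parameter, records the original range. *)
Definition window (H z : nat) : C := ((2 * H <= z < 3 * H)%N)%:R.

Lemma modulus_window H z : modulus (window H z) <= 1.
Proof. by rewrite /window; case: (_ && _); rewrite ?modulus1 ?modulus0. Qed.

Lemma avg_window (H t : nat) (Phi : int -> C) : (t <= 2 * H)%N ->
  \avg_(k < H) Phi (k : nat)%:Z =
  3 * \avg_(k < 3 * H) (window H (k + t) * Phi ((k + t)%N%:Z - (2 * H)%N%:Z)).
Proof.
move=> tH; have [H0|H0] := posnP H.
  by rewrite H0 /avg !big_ord0 !mul0r mulr0.
have e : \sum_(k < H) Phi (k : nat)%:Z =
    \sum_(k < 3 * H) window H (k + t) * Phi ((k + t)%N%:Z - (2 * H)%N%:Z).
  rewrite (eq_bigr (fun k : 'I_(3 * H) => if (2 * H <= k + t < 3 * H)%N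
    then Phi ((k + t)%N%:Z - (2 * H)%N%:Z) else 0)); last first.
    by move=> k _; rewrite /window; case: (_ && _); rewrite ?mul1r ?mul0r.
  rewrite -big_mkcond /=.
  have lt3 (k : 'I_H) : (k + 2 * H - t < 3 * H)%N by move: (ltn_ord k); lia.
  pose h k := Ordinal (lt3 k).
  pose h' (k : 'I_(3 * H)) : 'I_H := insubd (Ordinal H0) (k + t - 2 * H)%N.
  rewrite (reindex_onto h h') /=; last first.
    move=> k hk; apply: val_inj; rewrite /= val_insubd.
    by case: ifP; lia.
  apply: eq_big => [k|k _]; last by congr Phi; lia.
  rewrite (_ : h' _ == k); first by move: (ltn_ord k); lia.
  apply/eqP/val_inj; rewrite /h' val_insubd /=.
  by move: (ltn_ord k); case: ifP; lia.
rewrite /avg !card_ord e natrM.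
have Hn : H%:R != 0 :> C by rewrite pnatr_eq0; lia.
by field.
Qed.

(** The box in the directions d j and m k, based at y - m k, without its corner
    y; it is what remains of the box when the function at y is dropped. *)
Definition three_corners (E : G -> C) (r : G) (d m j k : int) (y : G) : C :=
  E (y - r * (m * k)%:~R) * (E (y - r * (m * k)%:~R + r * (d * j)%:~R))^* *
  E (y + r * (d * j)%:~R).

(** For fixed d, m, d', m' the six factors are grouped as the two corners with
    m k only, the two corners with m' k only, and the corner y + d' j'; the
    corner y + d j is the one to keep.  The moves
      y += m s,  k += s;
      y += m' t1,  k += t1,  j += t2;
      y -= d' u1,  j' += u1,  j += u2
    fix the first, second and third group, and displace the remaining corner by
    m s, m' t1 + d t2 and d u2 - d' u1.  The cut-offs that keep j, j', k in
    range depend on at most two of the three moves, so they join the factors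
    that the box inequality removes. *)
Lemma paired_box (E : G -> C) (r : G) (H : nat) (d m d' m' h0 l0 : int)
    (q := three_corners E r) :
  bounded1 E -> (0 < H)%N ->
  modulus (\avg_(k < H) \avg_(j < H) \avg_(j' < H) \avg_Y
    (q d m (h0 + (j : nat)%:Z) (l0 + (k : nat)%:Z) Y *
     (q d' m' (h0 + (j' : nat)%:Z) (l0 + (k : nat)%:Z) Y)^*)) ^+ 8
  <= 27 ^+ 8 * complex.Re (\avg_(s < H) \avg_(s1 < H)
       \avg_(t : 'I_H * 'I_H) \avg_(t1 : 'I_H * 'I_H)
       \avg_(u : 'I_H * 'I_H) \avg_(u1 : 'I_H * 'I_H) \avg_x
       mder (r * (d * ((u1.2 : nat)%:Z - (u.2 : nat)%:Z)
                  - d' * ((u1.1 : nat)%:Z - (u.1 : nat)%:Z))%:~R)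
        (mder (r * (m' * ((t1.1 : nat)%:Z - (t.1 : nat)%:Z)
                    + d * ((t1.2 : nat)%:Z - (t.2 : nat)%:Z))%:~R)
         (mder (r * (m * ((s1 : nat)%:Z - (s : nat)%:Z))%:~R) E)) x).
Proof.
move=> E1 H0; set W := complex.Re _; set V := avg _.
pose T : finType := ('I_H * 'I_H)%type.
pose l1 (s : 'I_H) : G := r * (m * (s : nat)%:Z)%:~R.
pose l2 (t : T) : G := r * (m' * (t.1 : nat)%:Z + d * (t.2 : nat)%:Z)%:~R.
pose l3 (u : T) : G := r * (d * (u.2 : nat)%:Z - d' * (u.1 : nat)%:Z)%:~R.
pose w (k : nat) : int := k%:Z - (2 * H)%N%:Z.
pose base (j : nat) : G := r * (d * (h0 + w j))%:~R.
(* A, B and D hold the first, second and third group together with the cut-offs;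
   the argument of each is that of the moved point, translated so that the
   remaining corner is based at x. *)
pose A (k j j' : nat) (x : G) (t u : T) : C :=
  let y := x - base j + r * (m' * (t.1 : nat)%:Z - d' * (u.1 : nat)%:Z
             - m * (l0 + w k + (t.1 : nat)%:Z))%:~R in
  window H (j + (t.2 + u.2)) * window H (j' + u.1) *
  E y * (E (y + r * (d * (h0 + w j + (t.2 : nat)%:Z + (u.2 : nat)%:Z))%:~R))^*.
pose B (k j j' : nat) (x : G) (s : 'I_H) (u : T) : C :=
  let y := x - base j + r * (m * (s : nat)%:Z - d' * (u.1 : nat)%:Z
             - m' * (l0 + w k + (s : nat)%:Z))%:~R in
  (E y)^* * E (y + r * (d' * (h0 + w j' + (u.1 : nat)%:Z))%:~R).
pose D (k j j' : nat) (x : G) (s : 'I_H) (t : T) : C :=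
  window H (k + (s + t.1)) *
  (E (x - base j + r * (m * (s : nat)%:Z + m' * (t.1 : nat)%:Z
        + d' * (h0 + w j'))%:~R))^*.
pose Q k j j' := \avg_x \avg_s \avg_t \avg_u
  (E (x + l1 s + l2 t + l3 u) * A k j j' x t u * B k j j' x s u * D k j j' x s t).
have QW k j j' : modulus (Q k j j') ^+ 8 <= W.
  have wb := modulus_window.
  have Ab o t : bounded1 (A k j j' o t).
    by move=> u; rewrite /A; do ! apply: modulusM_le1; rewrite ?modulus_conj.
  have Bb o t : bounded1 (B k j j' o t).
    by move=> u; rewrite /B; do ! apply: modulusM_le1; rewrite ?modulus_conj.
  have Db o t : bounded1 (D k j j' o t).
    by move=> u; rewrite /D; do ! apply: modulusM_le1; rewrite ?modulus_conj.
  have h := @group_box_cauchy_schwarz _ _ _ _ _ E l1 l2 l3 _ _ _ Ab Bb Db.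
  apply: (eq_Re_le h); apply: eq_avg => s; apply: eq_avg => s1; apply: eq_avg => t.
  apply: eq_avg => t1; apply: eq_avg => u; apply: eq_avg => u1; apply: eq_avg => x.
  have -> : l3 u1 - l3 u = r * (d * ((u1.2 : nat)%:Z - (u.2 : nat)%:Z)
                  - d' * ((u1.1 : nat)%:Z - (u.1 : nat)%:Z))%:~R by rewrite /l3; ring.
  have -> : l2 t1 - l2 t = r * (m' * ((t1.1 : nat)%:Z - (t.1 : nat)%:Z)
                    + d * ((t1.2 : nat)%:Z - (t.2 : nat)%:Z))%:~R by rewrite /l2; ring.
  by have -> : l1 s1 - l1 s = r * (m * ((s1 : nat)%:Z - (s : nat)%:Z))%:~R
    by rewrite /l1; ring.
have W0 : 0 <= W by apply: le_trans (QW 0%N 0%N 0%N); rewrite exprn_even_ge0.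
have cH : (0 < #|'I_H|)%N by rewrite card_ord.
have cT : (0 < #|T|)%N by rewrite card_prod card_ord muln_gt0 H0.
have VE : V = 27 * \avg_(k < 3 * H) \avg_(j < 3 * H) \avg_(j' < 3 * H) Q k j j'.
  transitivity (27 * \avg_(s < H) \avg_(t : T) \avg_(u : T)
    \avg_(k < 3 * H) \avg_(j < 3 * H) \avg_(j' < 3 * H) \avg_x
    (E (x + l1 s + l2 t + l3 u) * A k j j' x t u * B k j j' x s u * D k j j' x s t)).
    rewrite -[LHS](avg_const (I := 'I_H))// -avgZl; apply: eq_avg => s.
    rewrite -[LHS](avg_const (I := T))// -avgZl; apply: eq_avg => t.
    rewrite -[LHS](avg_const (I := T))// -avgZl; apply: eq_avg => u.
    have e1 : (s + t.1 <= 2 * H)%N by move: (ltn_ord s) (ltn_ord t.1); lia.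
    have e2 : (t.2 + u.2 <= 2 * H)%N by move: (ltn_ord t.2) (ltn_ord u.2); lia.
    have e3 : (u.1 <= 2 * H)%N by move: (ltn_ord u.1); lia.
    pose X k j j' := \avg_y (q d m (h0 + w (j + (t.2 + u.2))%N) (l0 + w (k + (s + t.1))%N) y *
      (q d' m' (h0 + w (j' + u.1)%N) (l0 + w (k + (s + t.1))%N) y)^*).
    transitivity (27 * \avg_(k < 3 * H) (window H (k + (s + t.1)) *
      \avg_(j < 3 * H) (window H (j + (t.2 + u.2)) *
      \avg_(j' < 3 * H) (window H (j' + u.1) * X k j j')))).
      rewrite /V (avg_window (fun k => \avg_(j < H) \avg_(j' < H) \avg_y
        (q d m (h0 + (j : nat)%:Z) (l0 + k) y *
        (q d' m' (h0 + (j' : nat)%:Z) (l0 + k) y)^*)) e1).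
      rewrite -[27]/((3 * 9)%N%:R) natrM -mulrA; congr (_ * _).
      rewrite -avgZl; apply: eq_avg => k; rewrite [RHS]mulrCA; congr (window _ _ * _).
      apply: etrans (avg_window (fun j => \avg_(j' < H) \avg_y
        (q d m (h0 + j) (l0 + w (k + (s + t.1))%N) y *
        (q d' m' (h0 + (j' : nat)%:Z) (l0 + w (k + (s + t.1))%N) y)^*)) e2) _.
      rewrite -[9]/((3 * 3)%N%:R) natrM -mulrA; congr (_ * _).
      rewrite -avgZl; apply: eq_avg => j; rewrite [RHS]mulrCA; congr (window _ _ * _).
      exact: (avg_window (fun j' => \avg_y
        (q d m (h0 + w (j + (t.2 + u.2))%N) (l0 + w (k + (s + t.1))%N) y *
        (q d' m' (h0 + j') (l0 + w (k + (s + t.1))%N) y)^*)) e3).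
    congr (_ * _); apply: eq_avg => k; rewrite -avgZl; apply: eq_avg => j.
    rewrite mulrCA -!avgZl; apply: eq_avg => j'.
    rewrite /X (avg_translate (- base j + r * (m * (s : nat)%:Z + m' * (t.1 : nat)%:Z
        - d' * (u.1 : nat)%:Z)%:~R)) -!avgZl.
    apply: eq_avg => x; rewrite /q /three_corners /A /B /D /l1 /l2 /l3 /base.
    rewrite !rmorphM /= !conjCK.
    set P1 := E _; set P2 := (E _)^*; set P3 := E _.
    set P4 := (E _)^*; set P5 := E _; set P6 := (E _)^*.
    set Q1 := E _; set Q2 := E _; set Q3 := (E _)^*.
    set Q4 := (E _)^*; set Q5 := E _; set Q6 := (E _)^*.
    have -> : P1 = Q2 by congr E; rewrite /w !PoszD; ring.
    have -> : P2 = Q3 by congr (_^*); congr E; rewrite /w !PoszD; ring.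
    have -> : P3 = Q1 by congr E; rewrite /w !PoszD; ring.
    have -> : P4 = Q4 by congr (_^*); congr E; rewrite /w !PoszD; ring.
    have -> : P5 = Q5 by congr E; rewrite /w !PoszD; ring.
    have -> : P6 = Q6 by congr (_^*); congr E; rewrite /w !PoszD; ring.
    ring.
  congr (_ * _).
  under eq_avg do under eq_avg do rewrite exchange_avg.
  under eq_avg do rewrite exchange_avg.
  rewrite exchange_avg; apply: eq_avg => k.
  under eq_avg do under eq_avg do rewrite exchange_avg.
  under eq_avg do rewrite exchange_avg.
  rewrite exchange_avg; apply: eq_avg => j.
  under eq_avg do under eq_avg do rewrite exchange_avg.
  under eq_avg do rewrite exchange_avg.
  rewrite exchange_avg; apply: eq_avg => j'.
  under eq_avg do under eq_avg do rewrite exchange_avg.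
  under eq_avg do rewrite exchange_avg.
  by rewrite exchange_avg.
rewrite VE modulusM modulus_nat exprMn ler_wpM2l ?exprn_ge0//.
apply: (le_trans (y := (\avg_(k < 3 * H) \avg_(j < 3 * H) \avg_(j' < 3 * H)
    modulus (Q k j j')) ^+ 8)).
  apply: ler_expr_nonneg; first exact: modulus_ge0.
  apply: le_trans (modulus_avg _) _; apply: ler_avg => k.
  apply: le_trans (modulus_avg _) _; apply: ler_avg => j.
  exact: le_trans (modulus_avg _) _.
have Q0 k j j' : 0 <= modulus (Q k j j') by exact: modulus_ge0.
apply: le_trans (avg_pow2_le 3 _) _; first by move=> k; do 2 (apply: avg_ge0 => ?).
apply: ler_avg_const => // k.
apply: le_trans (avg_pow2_le 3 _) _; first by move=> j; apply: avg_ge0.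
apply: ler_avg_const => // j.
apply: le_trans (avg_pow2_le 3 _) _; first by move=> j'.
by apply: ler_avg_const => // j'; exact: QW.
Qed.
End PairedBox.

(** * Concatenation for a box *)
Section BoxAverages.
Variables (R : rcfType) (G : finComNzRingType).
Local Notation C := R[i].

(** The factor at the corner y = x + m k does not depend on (i, j) once y and k
    are taken as parameters, so it drops out and (i, j) is doubled, while k stays
    common to both copies. *)
Lemma box_average_pairs (E : G -> C) (r : G) (H : nat) (d m : 'I_H -> int) (h0 l0 : int)
    (q := three_corners E r) : bounded1 E ->
  modulus (\avg_(i < H) \avg_(j < H) \avg_(k < H) \avg_x
     mder (r * (m i * (l0 + (k : nat)%:Z))%:~R)
       (mder (r * (d i * (h0 + (j : nat)%:Z))%:~R) E) x) ^+ 2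
  <= \avg_(i < H) \avg_(i' < H) modulus (\avg_(k < H) \avg_(j < H) \avg_(j' < H) \avg_y
    (q (d i) (m i) (h0 + (j : nat)%:Z) (l0 + (k : nat)%:Z) y *
     (q (d i') (m i') (h0 + (j' : nat)%:Z) (l0 + (k : nat)%:Z) y)^*)).
Proof.
move=> E1.
pose qq (i j k : 'I_H) y := q (d i) (m i) (h0 + (j : nat)%:Z) (l0 + (k : nat)%:Z) y.
set S := avg _.
have -> : S = \avg_(p : G * 'I_H) \avg_(t : 'I_H * 'I_H) ((E p.1)^* * qq t.1 t.2 p.2 p.1).
  rewrite -(pair_avg (fun y k => \avg_(t : 'I_H * 'I_H) ((E y)^* * qq t.1 t.2 k y))).
  rewrite exchange_avg.
  under [RHS]eq_avg do rewrite exchange_avg.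
  rewrite exchange_avg.
  rewrite -(pair_avg (fun i j => \avg_k \avg_y ((E y)^* * qq i j k y))).
  apply: eq_avg => i; apply: eq_avg => j; apply: eq_avg => k.
  rewrite (avg_translate (- r * (m i * (l0 + (k : nat)%:Z))%:~R)); apply: eq_avg => y.
  rewrite /qq /q /three_corners /mder ![(_ * _)^*]rmorphM /= !conjCK mulNr.
  set a := r * (m i * _)%:~R; set b := r * (d i * _)%:~R.
  have -> : y - a + a = y by rewrite subrK.
  ring.
have Eb : bounded1 (fun p : G * 'I_H => (E p.1)^*) by move=> p; rewrite modulus_conj.
apply: le_trans (drop_bounded_factor _ Eb) _; apply: le_trans (Re_modulus _) _.
rewrite (_ : avg _ = \avg_i \avg_i' \avg_k \avg_j \avg_j' \avg_y
    (qq i j k y * (qq i' j' k y)^*)).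
  apply: le_trans (modulus_avg _) _; apply: ler_avg => i; exact: modulus_avg.
rewrite -(pair_avg (fun y k => \avg_(t : 'I_H * 'I_H) \avg_(t' : 'I_H * 'I_H)
  (qq t.1 t.2 k y * (qq t'.1 t'.2 k y)^*))).
transitivity (\avg_y \avg_k \avg_i \avg_i' \avg_j \avg_j' (qq i j k y * (qq i' j' k y)^*)).
  apply: eq_avg => y; apply: eq_avg => k.
  rewrite -(pair_avg (fun i j => \avg_(t' : 'I_H * 'I_H) (qq i j k y * (qq t'.1 t'.2 k y)^*))).
  apply: eq_avg => i; rewrite [RHS]exchange_avg; apply: eq_avg => j.
  by rewrite (pair_avg (fun i' j' => qq i j k y * (qq i' j' k y)^*)).
under eq_avg do rewrite exchange_avg.
rewrite exchange_avg; apply: eq_avg => i.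
under eq_avg do rewrite exchange_avg.
rewrite exchange_avg; apply: eq_avg => i'.
rewrite exchange_avg; apply: eq_avg => k.
rewrite exchange_avg; apply: eq_avg => j.
by rewrite exchange_avg.
Qed.

(** One direction m h is still a product, the two others range over full
    intervals. *)
Definition box_corr (H : nat) (r : G) (E : G -> C) : R :=
  avg_sym (2 * H) (fun m => avg_sym (2 * H) (fun h =>
    avg_sym (16 * H ^ 2) (fun k => avg_sym (16 * H ^ 2) (fun l =>
      autocorr (mder (r * k%:~R) (mder (r * (m * h)%:~R) E)) (r * l%:~R))))).

(** After [box_average_pairs] and [paired_box] the two directions
    m' t1 + d t2 and d u2 - d' u1 have bounded multiplicity unless (m', d) or
    (d', d) is degenerate; the first direction depends only on d and on the
    range of s, and its parameters are then allowed to run freely. *)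
Lemma box_concatenation (E : G -> C) (r : G) (H K : nat) (d0 e h0 l0 : int) :
  bounded1 E -> (0 < H)%N -> (0 < K)%N ->
  - H%:Z <= d0 <= 0 -> - H%:Z <= e <= H%:Z ->
  modulus (\avg_(i < H) \avg_(j < H) \avg_(k < H) \avg_x
     mder (r * ((d0 + (i : nat)%:Z + e) * (l0 + (k : nat)%:Z))%:~R)
       (mder (r * ((d0 + (i : nat)%:Z) * (h0 + (j : nat)%:Z))%:~R) E) x) ^+ 16
  <= 27 ^+ 8 * (24 / K%:R + 2 ^+ 14 * K%:R ^+ 4 * box_corr H r E).
Proof.
move=> E1 H0 K0 hd0 he.
pose d (i : 'I_H) := d0 + (i : nat)%:Z; pose m i := d i + e.
pose L := (16 * H ^ 2)%N.
pose psi a b c := autocorr (mder (r * b%:~R) (mder (r * a%:~R) E)) (r * c%:~R).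
have psi0 a b c : 0 <= psi a b c by exact: autocorr_ge0.
have psi1 a b c : psi a b c <= 1 by apply: autocorr_le1; do 2 apply: bounded1_mder.
pose psi2 a := avg_sym L (fun b => avg_sym L (psi a b)).
have psi20 a : 0 <= psi2 a by do 2 (apply: avg_sym_ge0 => ?).
pose T : finType := ('I_H * 'I_H)%type.
have cH : (0 < #|'I_H|)%N by rewrite card_ord.
have cT : (0 < #|T|)%N by rewrite card_prod card_ord muln_gt0 H0.
pose dt a b (t t1 : T) := a * ((t1.1 : nat)%:Z - (t.1 : nat)%:Z)
                    + b * ((t1.2 : nat)%:Z - (t.2 : nat)%:Z).
pose F (q : 'I_H * 'I_H) := \avg_(s < H) \avg_(s1 < H)
  \avg_(t : T) \avg_(t1 : T) \avg_(u : T) \avg_(u1 : T)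
   psi (m q.2 * ((s1 : nat)%:Z - (s : nat)%:Z)) (dt (m q.1) (d q.2) t t1)
       (dt (- d q.1) (d q.2) u u1).
have SF : modulus (\avg_(i < H) \avg_(j < H) \avg_(k < H) \avg_x
     mder (r * (m i * (l0 + (k : nat)%:Z))%:~R)
       (mder (r * (d i * (h0 + (j : nat)%:Z))%:~R) E) x) ^+ 16 <= 27 ^+ 8 * avg F.
  rewrite (exprM _ 2 8); apply: le_trans (ler_expr_nonneg 8 _ (box_average_pairs r d m h0 l0 E1)) _.
    by rewrite exprn_ge0 ?modulus_ge0.
  apply: le_trans (avg_pow2_le 3 _) _.
    by move=> i; apply: avg_ge0 => i'; exact: modulus_ge0.
  rewrite -avgZl -(pair_avg (fun i' i => 27 ^+ 8 * F (i', i))) exchange_avg.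
  apply: ler_avg => i; apply: le_trans (avg_pow2_le 3 _) _.
    by move=> i'; exact: modulus_ge0.
  apply: ler_avg => i'; apply: le_trans (paired_box r (d i) (m i) (d i') (m i') h0 l0 E1 H0) _.
  rewrite ler_wpM2l ?exprn_ge0//; apply: le_trans (Re_modulus _) _.
  do 6 (apply: le_trans (modulus_avg _) _; apply: ler_avg => ?).
  by rewrite /psi /autocorr /dt mulNr [- _ + _]addrC.
apply: le_trans SF _; rewrite ler_wpM2l ?exprn_ge0//.
pose B := degenerate_pairs H K (d0 + e) d0 :|: degenerate_pairs H K d0 d0.
pose g (q : 'I_H * 'I_H) : R := 2 ^+ 10 * K%:R ^+ 4 *
  \avg_(s < H) \avg_(s1 < H) psi2 (m q.2 * ((s1 : nat)%:Z - (s : nat)%:Z)).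
have g0 q : 0 <= g q.
  apply: mulr_ge0; first by rewrite mulr_ge0 ?exprn_ge0 ?ler0n.
  by do 2 (apply: avg_ge0 => ?).
have Hn : H%:R != 0 :> R by rewrite pnatr_eq0; lia.
have ring1 (c n : R) : n != 0 -> c ^+ 2 * (2 * (16 * (n * n))) / (n * n) = 32 * c ^+ 2.
  by move=> n0; field.
have push (a b : int) (t : T) (f : int -> R) : (forall k, 0 <= f k) ->
    ~~ degenerate H K a b -> `|a| <= (2 * H)%N%:Z -> `|b| <= (2 * H)%N%:Z ->
    \avg_(t1 : T) f (dt a b t t1) <= 32 * K%:R ^+ 2 * avg_sym L f.
  move=> f0 nd ha hb.
  apply: le_trans (@avg_pushforward _ _ (dt a b t) L (K ^ 2) f f0 _ _) _.
  - move=> t1; rewrite /dt /L; move: (ltn_ord t1.1) (ltn_ord t1.2) (ltn_ord t.1) (ltn_ord t.2).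
    set x1 := nat_of_ord t1.1; set x2 := nat_of_ord t1.2.
    set x3 := nat_of_ord t.1; set x4 := nat_of_ord t.2; move=> y1 y2 y3 y4.
    have z1 : `|x1%:Z - x3%:Z| <= H%:Z by lia.
    have z2 : `|x2%:Z - x4%:Z| <= H%:Z by lia.
    have w1 : `|a * (x1%:Z - x3%:Z)| <= (2 * H)%N%:Z * H%:Z by rewrite normrM ler_pM.
    have w2 : `|b * (x2%:Z - x4%:Z)| <= (2 * H)%N%:Z * H%:Z by rewrite normrM ler_pM.
    move: w1 w2; set w1 := a * _; set w2 := b * _; nia.
  - move=> k; apply: leq_trans (few_solutions (k + a * (t.1 : nat)%:Z + b * (t.2 : nat)%:Z) nd).
    apply: subset_leq_card; apply/fintype.subsetP => p; rewrite !inE /dt => /eqP <-.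
    by apply/eqP; ring.
  - rewrite ler_wpM2r ?avg_sym_ge0// card_prod card_ord /L -!mulnn !natrM.
    by rewrite -expr2 ring1.
have dH i : `|d i| <= (2 * H)%N%:Z by rewrite /d; move: (ltn_ord i); lia.
have mH i : - (2 * H)%N%:Z <= m i < (2 * H)%N%:Z by rewrite /m /d; move: (ltn_ord i); lia.
apply: (le_trans (@avg_outside _ _ B F g (24 / K%:R) _ _ _ g0 _)).
- by rewrite divr_ge0 ?ler0n.
- have bn : (`|d0| <= H)%N by lia.
  have B1 := card_degenerate K (d0 + e) bn; have B2 := card_degenerate K d0 bn.
  rewrite card_prod card_ord mulrAC ler_pdivlMr ?ltr0n// -natrM -natrM ler_nat.
  rewrite mulnC; apply: leq_trans (leq_mul (leqnn K) (leq_card_setU _ _)) _.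
  by rewrite mulnDr mulnn; lia.
- by move=> q; do 6 (apply: ler_avg_const => // ?).
- move=> q; rewrite !inE negb_or => /andP[nd1 nd2].
  have {}nd1 : ~~ degenerate H K (m q.1) (d q.2) by rewrite /m /d addrAC.
  have {}nd2 : ~~ degenerate H K (- d q.1) (d q.2) by rewrite /degenerate abszN.
  rewrite /g -avgZl; apply: ler_avg => s; rewrite -avgZl; apply: ler_avg => s1.
  set k2 := m q.2 * _.
  have c0 : 0 <= 32 * K%:R ^+ 2 :> R by rewrite mulr_ge0 ?exprn_ge0 ?ler0n.
  have -> : 2 ^+ 10 * K%:R ^+ 4 * psi2 k2 = 32 * K%:R ^+ 2 * (32 * K%:R ^+ 2 * psi2 k2) :> R.
    by ring.
  have psi3 b : 0 <= avg_sym L (psi k2 b) by apply: avg_sym_ge0.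
  apply: ler_avg_const => [|t]; first by apply: mulr_ge0 => //; exact: mulr_ge0.
  apply: (le_trans (y := \avg_(t1 : T) (32 * K%:R ^+ 2 *
      avg_sym L (psi k2 (dt (m q.1) (d q.2) t t1))))).
    apply: ler_avg => t1; apply: ler_avg_const => [|u]; first exact: mulr_ge0.
    by apply: push => //; rewrite normrN.
  rewrite avgZl ler_wpM2l//; apply: push => //.
  by have := mH q.1; lia.
rewrite lerD2l /g avgZl.
have -> : 2 ^+ 14 * K%:R ^+ 4 = 2 ^+ 10 * K%:R ^+ 4 * 16 :> R by ring.
rewrite -[leRHS]mulrA ler_wpM2l ?mulr_ge0 ?exprn_ge0 ?ler0n//.
rewrite -(pair_avg (fun i' i => \avg_(s < H) \avg_(s1 < H)
  psi2 (m i * ((s1 : nat)%:Z - (s : nat)%:Z)))).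
have ring2 (n : R) : n != 0 -> 1%:R * (2 * (2 * n)) / n = 4 by move=> n0; field.
pose psi4 k := avg_sym (2 * H) (fun h => psi2 (k * h)).
have psi40 k : 0 <= psi4 k by apply: avg_sym_ge0.
have psi41 : 0 <= avg_sym (2 * H) psi4 by apply: avg_sym_ge0.
have -> : 16 = 4 * 4 :> R by ring.
rewrite -mulrA.
apply: ler_avg_const => [|i']; first by apply: mulr_ge0 => //; exact: mulr_ge0.
apply: (le_trans (y := \avg_(i < H) (4 * psi4 (m i)))); last first.
  rewrite avgZl ler_wpM2l//.
  apply: le_trans (@avg_pushforward _ _ m (2 * H) 1 psi4 psi40 mH _) _.
    move=> k; apply/card_le1_eqP => i j; rewrite !inE /m /d => /eqP <- /eqP.
    by move=> h; apply: val_inj => /=; lia.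
  by rewrite card_ord !natrM ring2.
apply: ler_avg => i; apply: ler_avg_const => [|s]; first exact: mulr_ge0.
apply: le_trans (@avg_pushforward _ _ (fun s1 : 'I_H => (s1 : nat)%:Z - (s : nat)%:Z)
  (2 * H) 1 (fun h => psi2 (m i * h)) _ _ _) _.
- by move=> k.
- by move=> s1; move: (ltn_ord s1) (ltn_ord s); lia.
- move=> k; apply/card_le1_eqP => i1 j1; rewrite !inE => /eqP <- /eqP.
  by move=> h; apply: val_inj => /=; lia.
- by rewrite card_ord !natrM ring2.
Qed.
End BoxAverages.

(** * Four full directions *)
Section AvgSym.
Variable R : realFieldType.
Implicit Types F : int -> R.

Lemma avg_sym_const n (c : R) : (0 < n)%N -> avg_sym n (fun=> c) = c.
Proof. by move=> n0; rewrite /avg_sym avg_const// card_ord; lia. Qed.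

Lemma avg_symZl n (c : R) F : avg_sym n (fun k => c * F k) = c * avg_sym n F.
Proof. by rewrite /avg_sym avgZl. Qed.

Lemma avg_symD n F F' : avg_sym n (fun k => F k + F' k) = avg_sym n F + avg_sym n F'.
Proof. by rewrite /avg_sym avgD. Qed.

Lemma avg_sym_sqr_le n F : avg_sym n F ^+ 2 <= avg_sym n (fun k => F k ^+ 2).
Proof. exact: avg_sqr_le. Qed.

Lemma avg_sym_affine n (a b : R) F : (0 < n)%N ->
  avg_sym n (fun k => a + b * F k) = a + b * avg_sym n F.
Proof. by move=> n0; rewrite avg_symD avg_symZl avg_sym_const. Qed.

(** The form in which [bilinear_concatenation] is averaged over the directions
    that it leaves alone. *)
Lemma avg_sym_sqr_affine n (a b : R) F F' : (0 < n)%N ->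
  (forall k, F k ^+ 2 <= a + b * F' k) ->
  avg_sym n F ^+ 2 <= a + b * avg_sym n F'.
Proof.
move=> n0 FF'; rewrite -avg_sym_affine//; apply: le_trans (avg_sym_sqr_le _ _) _.
exact: ler_avg_sym.
Qed.

Lemma avg_sym_sub (n m : nat) F : (forall k, 0 <= F k) -> (0 < n <= m)%N ->
  avg_sym n F <= m%:R / n%:R * avg_sym m F.
Proof.
move=> F0 nm; apply: le_trans (@avg_pushforward _ _
  (fun k : 'I_(2 * n) => (k : nat)%:Z - n%:Z) m 1 F F0 _ _) _.
- by move=> k; move: (ltn_ord k); lia.
- move=> k; apply/card_le1_eqP => i j; rewrite !inE => /eqP <- /eqP h.
  by apply: val_inj => /=; lia.
- rewrite card_ord !natrM; have n0 : n%:R != 0 :> R by rewrite pnatr_eq0; lia.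
  have e (x y z : R) : x != 0 -> 1%:R * (2 * y) / (2 * x) * z = y / x * z.
    by move=> x0; field.
  by rewrite e.
Qed.

Lemma avg_sym_zero (m : nat) F : (forall k, 0 <= F k) -> (0 < m)%N ->
  F 0 <= (2 * m)%:R * avg_sym m F.
Proof.
move=> F0 m0; have := @avg_pushforward _ unit (fun=> 0) m 1 F F0 _ _.
rewrite card_unit avg_const ?card_unit// mul1r divr1; apply; first by lia.
by move=> k; apply: leq_trans (max_card _) _; rewrite card_unit.
Qed.
End AvgSym.

Section Tradeoff.
Variable R : realType.

(** The concatenation bounds hold for every threshold K; the choice of K of order
    a / s^p turns them into a polynomial lower bound. *)
Lemma lower_bound_from_tradeoff (a b : R) (p j : nat) : 0 < a -> 0 < b ->
  exists c D, 0 < c /\ forall s psi : R, 0 < s <= 1 ->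
    (forall K : nat, (0 < K)%N -> s ^+ p <= a / K%:R + b * K%:R ^+ j * psi) ->
    c * s ^+ D <= psi.
Proof.
move=> a0 b0; exists (2 * b * (2 * a + 1) ^+ j)^-1, (p + p * j)%N.
have a1 : 0 < 2 * a + 1 by rewrite addr_gt0 ?mulr_gt0.
split=> [|s psi /andP[s0 s1] hK]; first by rewrite invr_gt0 !mulr_gt0 ?exprn_gt0.
have sp0 : 0 < s ^+ p by rewrite exprn_gt0.
have sp1 : s ^+ p <= 1 by rewrite exprn_ile1// ltW.
pose K := (Num.truncn (2 * a / s ^+ p)).+1.
have x0 : 0 <= 2 * a / s ^+ p by rewrite divr_ge0 ?mulr_ge0 ?ltW.
have K1 : 2 * a / s ^+ p < K%:R by rewrite /K truncnS_gt.
have K2 : K%:R <= (2 * a + 1) / s ^+ p.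
  rewrite mulrDl mul1r /K -natr1 lerD ?truncn_le//.
  by rewrite -[leLHS]invr1 lef_pV2 ?posrE.
have K0 : 0 < K%:R :> R by rewrite ltr0n.
have := hK K isT.
have aK : a / K%:R <= s ^+ p / 2.
  rewrite ler_pdivrMr// mulrC mulrA ler_pdivlMr// -[leLHS]mulrC.
  by rewrite -ler_pdivrMr// ltW.
move=> h; have {}h : s ^+ p / 2 <= b * K%:R ^+ j * psi by lra.
have psi0 : 0 <= psi.
  rewrite -(pmulr_rge0 _ (_ : 0 < b * K%:R ^+ j)); last by rewrite mulr_gt0 ?exprn_gt0.
  by apply: le_trans h; rewrite divr_ge0 ?ltW.
have Kj : K%:R ^+ j <= (2 * a + 1) ^+ j / s ^+ p ^+ j.
  by rewrite -expr_div_n; apply: ler_expr_nonneg => //; rewrite ltW.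
have {}h : s ^+ p / 2 <= b * ((2 * a + 1) ^+ j / s ^+ p ^+ j) * psi.
  by apply: le_trans h _; rewrite ler_wpM2r// ler_wpM2l// ltW.
have spj : 0 < s ^+ p ^+ j by rewrite exprn_gt0.
have aj : 0 < (2 * a + 1) ^+ j by rewrite exprn_gt0.
rewrite mulrC ler_pdivrMr ?mulr_gt0// exprD exprM.
move: h; set u := s ^+ p; set v := u ^+ j; set w := (2 * a + 1) ^+ j => h.
have v0 : 0 < v by [].
have -> : u * v = (u / 2) * (2 * v) by field.
apply: (le_trans (y := b * (w / v) * psi * (2 * v))).
  by rewrite ler_wpM2r// mulr_ge0// ltW.
rewrite le_eqVlt; apply/orP; left; apply/eqP; field.
by rewrite gt_eqF.
Qed.
End Tradeoff.

Section Concatenating.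
Variables (R : realType) (G : finComNzRingType).
Local Notation C := R[i].
Implicit Types f : G -> C.

Lemma autocorr_mderC f (r : G) (h k : G) : autocorr (mder h f) k = autocorr (mder k f) h.
Proof. by rewrite /autocorr; congr modulus; apply: eq_avg => x; rewrite mderC. Qed.

Lemma eq_autocorr f f' h : f =1 f' -> autocorr f h = autocorr f' h.
Proof.
by move=> ff; rewrite /autocorr; congr modulus; apply: eq_avg => x; rewrite (eq_mder _ ff).
Qed.

Definition cube_corr (L : nat) (r : G) f : R :=
  avg_sym L (fun k1 => avg_sym L (fun k2 => avg_sym L (fun k3 => avg_sym L (fun k4 =>
    autocorr (mder (r * k3%:~R) (mder (r * k2%:~R) (mder (r * k1%:~R) f))) (r * k4%:~R))))).

Definition mixed_corr (H : nat) (r : G) f : R :=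
  avg_sym (2 * H) (fun e => avg_sym (2 * H) (fun h =>
    box_corr H r (mder (r * (e * h)%:~R) f))).

Definition semimixed_corr (H : nat) (r : G) f : R :=
  avg_sym (2 * H) (fun e => avg_sym (2 * H) (fun h =>
   avg_sym (16 * H ^ 2) (fun k => avg_sym (16 * H ^ 2) (fun l =>
   avg_sym (16 * H ^ 2) (fun j =>
   autocorr (mder (r * l%:~R) (mder (r * k%:~R) (mder (r * (e * h)%:~R) f)))
     (r * j%:~R)))))).

(** Multiplicative derivatives commute, so the directions may be treated in any
    order: here the direction m g is opened up. *)
Lemma mixed_corr_le (H K : nat) (r : G) f : bounded1 f -> (0 < H)%N -> (0 < K)%N ->
  mixed_corr H r f ^+ 2 <= 12 / K%:R + 2 * K%:R ^+ 2 * semimixed_corr H r f.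
Proof.
move=> f1 H0 K0; have H2 : (0 < 2 * H)%N by lia.
have L0 : (0 < 16 * H ^ 2)%N by rewrite muln_gt0 expn_gt0 H0.
have L4 : (16 * H ^ 2 = 4 * (2 * H) ^ 2)%N by lia.
apply: avg_sym_sqr_affine => // e; apply: avg_sym_sqr_affine => // h.
set F := mder _ f; have F1 : bounded1 F by exact: bounded1_mder.
rewrite (_ : box_corr _ _ _ = avg_sym (16 * H ^ 2) (fun k => avg_sym (16 * H ^ 2) (fun l =>
   avg_sym (2 * H) (fun m => avg_sym (2 * H) (fun g =>
   autocorr (mder (r * l%:~R) (mder (r * k%:~R) F)) (r * (m * g)%:~R)))))).
  apply: avg_sym_sqr_affine => // k; apply: avg_sym_sqr_affine => // l.
  by rewrite L4; apply: bilinear_concatenation => //; do 2 apply: bounded1_mder.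
rewrite /box_corr; under eq_avg_sym do rewrite exchange_avg_sym.
rewrite exchange_avg_sym; apply: eq_avg_sym => k.
under eq_avg_sym do rewrite exchange_avg_sym.
rewrite exchange_avg_sym; apply: eq_avg_sym => l.
apply: eq_avg_sym => m; apply: eq_avg_sym => g.
rewrite (eq_autocorr (f' := mder (r * (m * g)%:~R) (mder (r * k%:~R) F))); last exact: mderC.
by rewrite autocorr_mderC.
Qed.

(** The same for the last direction e h that is a product. *)
Lemma semimixed_corr_le (H K : nat) (r : G) f : bounded1 f -> (0 < H)%N -> (0 < K)%N ->
  semimixed_corr H r f ^+ 2 <= 12 / K%:R + 2 * K%:R ^+ 2 * cube_corr (16 * H ^ 2) r f.
Proof.
move=> f1 H0 K0; have H2 : (0 < 2 * H)%N by lia.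
have L0 : (0 < 16 * H ^ 2)%N by rewrite muln_gt0 expn_gt0 H0.
have L4 : (16 * H ^ 2 = 4 * (2 * H) ^ 2)%N by lia.
rewrite (_ : semimixed_corr _ _ _ = avg_sym (16 * H ^ 2) (fun k =>
   avg_sym (16 * H ^ 2) (fun l => avg_sym (16 * H ^ 2) (fun j =>
   avg_sym (2 * H) (fun e => avg_sym (2 * H) (fun h =>
   autocorr (mder (r * j%:~R) (mder (r * l%:~R) (mder (r * k%:~R) f)))
     (r * (e * h)%:~R))))))).
  apply: avg_sym_sqr_affine => // k; apply: avg_sym_sqr_affine => // l.
  apply: avg_sym_sqr_affine => // j.
  by rewrite L4; apply: bilinear_concatenation => //; do 3 apply: bounded1_mder.
rewrite /semimixed_corr.
under eq_avg_sym do rewrite exchange_avg_sym.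
rewrite exchange_avg_sym; apply: eq_avg_sym => k.
under eq_avg_sym do rewrite exchange_avg_sym.
rewrite exchange_avg_sym; apply: eq_avg_sym => l.
under eq_avg_sym do rewrite exchange_avg_sym.
rewrite exchange_avg_sym; apply: eq_avg_sym => j.
apply: eq_avg_sym => e; apply: eq_avg_sym => h.
rewrite (eq_autocorr (f' := mder (r * (e * h)%:~R) (mder (r * l%:~R) (mder (r * k%:~R) f)))).
  by rewrite autocorr_mderC.
by move=> x; rewrite (eq_mder _ (mderC _ _ _)) mderC.
Qed.

Lemma ratio4 (n : R) : n != 0 -> 1%:R * (2 * (2 * n)) / n = 4.
Proof. by move=> n0; field. Qed.

Lemma avg_difference_le (H : nat) (Y : int -> R) (i : 'I_H) : (forall k, 0 <= Y k) ->
  \avg_(j < H) Y ((j : nat)%:Z - (i : nat)%:Z) <= 4 * avg_sym (2 * H) Y.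
Proof.
move=> Y0; apply: le_trans (@avg_pushforward _ _
  (fun j : 'I_H => (j : nat)%:Z - (i : nat)%:Z) (2 * H) 1 Y Y0 _ _) _.
- by move=> j; move: (ltn_ord i) (ltn_ord j); lia.
- move=> k; apply/card_le1_eqP => j j'; rewrite !inE => /eqP <- /eqP h.
  by apply: val_inj => /=; lia.
- by rewrite card_ord !natrM ratio4// pnatr_eq0; move: (ltn_ord i); lia.
Qed.

Lemma avg_product_difference_le (H : nat) (Xi : int -> R) : (forall k, 0 <= Xi k) ->
  \avg_(b < H) \avg_(b' < H) \avg_(s < H) \avg_(s' < H)
    Xi (((b' : nat)%:Z - (b : nat)%:Z) * ((s : nat)%:Z - (s' : nat)%:Z))
  <= 16 * avg_sym (2 * H) (fun e => avg_sym (2 * H) (fun h => Xi (e * h))).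
Proof.
move=> Xi0; pose Y e := avg_sym (2 * H) (fun h => Xi (e * h)).
have Y0 e : 0 <= Y e by apply: avg_sym_ge0 => k; exact: Xi0.
have -> : 16 = 4 * 4 :> R by ring.
rewrite -mulrA -/(Y _).
apply: ler_avg_const => [|b].
  by apply: mulr_ge0 => //; apply: mulr_ge0 => //; exact: avg_sym_ge0.
apply: (le_trans (y := \avg_(b' < H) (4 * Y ((b' : nat)%:Z - (b : nat)%:Z)))).
  apply: ler_avg => b'; rewrite exchange_avg.
  apply: ler_avg_const => [|s']; first exact: mulr_ge0.
  by apply: (avg_difference_le (Y := fun h => Xi (((b' : nat)%:Z - (b : nat)%:Z) * h))).
by rewrite avgZl ler_wpM2l// avg_difference_le.
Qed.

(** The average that [linearisation] produces, with the parameters arranged as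
    [box_concatenation] expects them. *)
Definition linear_average (H : nat) (r : G) f : R :=
  \avg_(a < H) \avg_(b < H) \avg_(b' < H) \avg_(s < H) \avg_(s' < H)
     \avg_(t' < H) \avg_(u' < H) modulus (\avg_(a' < H) \avg_(t < H) \avg_(u < H) \avg_x
        mder (r * (a'%:R - a%:R + (b'%:R - b%:R)) * (u%:R - u'%:R))
          (mder (r * (a'%:R - a%:R) * (t%:R - t'%:R))
            (mder (r * (b'%:R - b%:R) * (s%:R - s'%:R)) f)) x).

(** The direction (b' - b) (s - s') stays fixed in [box_concatenation]; afterwards
    its two factors are released, each difference taking any value at most H
    times. *)
Lemma linear_average_le (H K : nat) (r : G) f : bounded1 f -> (0 < H)%N -> (0 < K)%N ->
  linear_average H r f ^+ 16 <=
    27 ^+ 8 * 24 / K%:R + 27 ^+ 8 * 2 ^+ 18 * K%:R ^+ 4 * mixed_corr H r f.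
Proof.
move=> f1 H0 K0; have cH : (0 < #|'I_H|)%N by rewrite card_ord.
pose Xi (k : int) : R := box_corr H r (mder (r * k%:~R) f).
have Xi0 k : 0 <= Xi k.
  by do 4 (apply: avg_sym_ge0 => ?); exact: autocorr_ge0.
pose a0 : R := 27 ^+ 8 * 24 / K%:R; pose c0 : R := 27 ^+ 8 * 2 ^+ 14 * K%:R ^+ 4.
have c00 : 0 <= c0 by rewrite /c0 !mulr_ge0 ?exprn_ge0 ?ler0n.
apply: (le_trans (y := \avg_(a < H) \avg_(b < H) \avg_(b' < H) \avg_(s < H) \avg_(s' < H)
     \avg_(t' < H) \avg_(u' < H)
   (a0 + c0 * Xi (((b' : nat)%:Z - (b : nat)%:Z) * ((s : nat)%:Z - (s' : nat)%:Z))))).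
  apply: le_trans (avg_pow2_le 4 _) _; last apply: ler_avg => a.
    by move=> ?; do 6 (apply: avg_ge0 => ?); exact: modulus_ge0.
  apply: le_trans (avg_pow2_le 4 _) _; last apply: ler_avg => b.
    by move=> ?; do 5 (apply: avg_ge0 => ?); exact: modulus_ge0.
  apply: le_trans (avg_pow2_le 4 _) _; last apply: ler_avg => b'.
    by move=> ?; do 4 (apply: avg_ge0 => ?); exact: modulus_ge0.
  apply: le_trans (avg_pow2_le 4 _) _; last apply: ler_avg => s.
    by move=> ?; do 3 (apply: avg_ge0 => ?); exact: modulus_ge0.
  apply: le_trans (avg_pow2_le 4 _) _; last apply: ler_avg => s'.
    by move=> ?; do 2 (apply: avg_ge0 => ?); exact: modulus_ge0.
  apply: le_trans (avg_pow2_le 4 _) _; last apply: ler_avg => t'.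
    by move=> ?; apply: avg_ge0 => ?; exact: modulus_ge0.
  apply: le_trans (avg_pow2_le 4 _) _; last apply: ler_avg => u'.
    by move=> ?; exact: modulus_ge0.
  pose k1 := ((b' : nat)%:Z - (b : nat)%:Z) * ((s : nat)%:Z - (s' : nat)%:Z).
  have F1 : bounded1 (mder (r * k1%:~R) f) by exact: bounded1_mder.
  pose S := \avg_(i < H) \avg_(j < H) \avg_(k < H) \avg_x
     mder (r * ((- (a : nat)%:Z + (i : nat)%:Z + ((b' : nat)%:Z - (b : nat)%:Z)) *
       (- (u' : nat)%:Z + (k : nat)%:Z))%:~R)
     (mder (r * ((- (a : nat)%:Z + (i : nat)%:Z) * (- (t' : nat)%:Z + (j : nat)%:Z))%:~R)
       (mder (r * k1%:~R) f)) x.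
  have h : - H%:Z <= - (a : nat)%:Z <= 0 ->
      - H%:Z <= (b' : nat)%:Z - (b : nat)%:Z <= H%:Z ->
      modulus S ^+ 16 <= 27 ^+ 8 * (24 / K%:R + 2 ^+ 14 * K%:R ^+ 4 * Xi k1).
    exact: box_concatenation.
  set S' := avg _; have SS' : S' = S.
    apply: eq_avg => a'; apply: eq_avg => t; apply: eq_avg => u; apply: eq_avg => x.
    have e1 : r * (a'%:R - a%:R + (b'%:R - b%:R)) * (u%:R - u'%:R) =
      r * ((- (a : nat)%:Z + (a' : nat)%:Z + ((b' : nat)%:Z - (b : nat)%:Z)) *
           (- (u' : nat)%:Z + (u : nat)%:Z))%:~R by ring.
    have e2 : r * (a'%:R - a%:R) * (t%:R - t'%:R) =
      r * ((- (a : nat)%:Z + (a' : nat)%:Z) * (- (t' : nat)%:Z + (t : nat)%:Z))%:~R by ring.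
    have e3 : r * (b'%:R - b%:R) * (s%:R - s'%:R) = r * k1%:~R by rewrite /k1; ring.
    by rewrite e1 e2 e3.
  rewrite SS' -[(2 ^ 4)%N]/16%N; apply: le_trans (h _ _) _.
  - by move: (ltn_ord a); lia.
  - by move: (ltn_ord b) (ltn_ord b'); lia.
  - by rewrite /a0 /c0 mulrDr !mulrA.
have := avg_product_difference_le H Xi0; rewrite -/(mixed_corr H r f) => hXi.
apply: (le_trans (y := a0 + c0 * (16 * mixed_corr H r f))); last first.
  by rewrite le_eqVlt /a0 /c0; apply/orP; left; apply/eqP; ring.
apply: (le_trans _ (_ : a0 + c0 * \avg_(b < H) \avg_(b' < H) \avg_(s < H) \avg_(s' < H)
   Xi (((b' : nat)%:Z - (b : nat)%:Z) * ((s : nat)%:Z - (s' : nat)%:Z)) <= _));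
  last by rewrite lerD2l ler_wpM2l.
rewrite avg_const//.
have fold_avg (F : 'I_H -> R) : \avg_i (a0 + c0 * F i) = a0 + c0 * avg F.
  by rewrite avgD avg_const// avgZl.
under eq_avg do under eq_avg do under eq_avg do under eq_avg do
  under eq_avg do rewrite avg_const//.
under eq_avg do under eq_avg do under eq_avg do under eq_avg do rewrite avg_const//.
under eq_avg do under eq_avg do under eq_avg do rewrite fold_avg.
under eq_avg do under eq_avg do rewrite fold_avg.
under eq_avg do rewrite fold_avg.
by rewrite fold_avg.
Qed.

Lemma cube_corr_ge0 L (r : G) f : 0 <= cube_corr L r f.
Proof. by do 4 (apply: avg_sym_ge0 => ?); exact: autocorr_ge0. Qed.

Lemma avg_sym_le1 L (F : int -> R) : (forall k, F k <= 1) -> avg_sym L F <= 1.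
Proof. by move=> F1; apply: ler_avg_const. Qed.

Lemma mixed_corr_le1 H (r : G) f : bounded1 f -> mixed_corr H r f <= 1.
Proof.
move=> f1; do 6 (apply: avg_sym_le1 => ?).
by apply: autocorr_le1; do 3 apply: bounded1_mder.
Qed.

Lemma semimixed_corr_le1 H (r : G) f : bounded1 f -> semimixed_corr H r f <= 1.
Proof.
move=> f1; do 5 (apply: avg_sym_le1 => ?).
by apply: autocorr_le1; do 3 apply: bounded1_mder.
Qed.

Lemma linear_average_le1 H (r : G) f : bounded1 f -> linear_average H r f <= 1.
Proof.
move=> f1; do 7 (apply: ler_avg_const => // ?).
do 4 (apply: bounded1_avg => ?).
by do 3 apply: bounded1_mder.
Qed.

Lemma avg_sym_cube_sub (n m : nat) (F : int -> int -> int -> int -> R) :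
  (forall a b c d, 0 <= F a b c d) -> (0 < n <= m)%N ->
  avg_sym n (fun a => avg_sym n (fun b => avg_sym n (fun c => avg_sym n (F a b c))))
  <= (m%:R / n%:R) ^+ 4 *
  avg_sym m (fun a => avg_sym m (fun b => avg_sym m (fun c => avg_sym m (F a b c)))).
Proof.
move=> F0 nm; set q := m%:R / n%:R.
have q0 : 0 <= q by rewrite divr_ge0.
apply: le_trans (avg_sym_sub _ nm) _; first by move=> a; do 3 (apply: avg_sym_ge0 => ?).
rewrite -/q exprS -[leRHS]mulrA ler_wpM2l// -avg_symZl; apply: ler_avg_sym => a.
apply: le_trans (avg_sym_sub _ nm) _; first by move=> b; do 2 (apply: avg_sym_ge0 => ?).
rewrite -/q exprS -[leRHS]mulrA ler_wpM2l// -avg_symZl; apply: ler_avg_sym => b.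
apply: le_trans (avg_sym_sub _ nm) _; first by move=> c; apply: avg_sym_ge0.
rewrite -/q exprS -[leRHS]mulrA ler_wpM2l// -avg_symZl; apply: ler_avg_sym => c.
by rewrite expr1; apply: avg_sym_sub.
Qed.

Lemma avg_sym_cube_zero (m : nat) (F : int -> int -> int -> int -> R) :
  (forall a b c d, 0 <= F a b c d) -> (0 < m)%N ->
  F 0 0 0 0 <= (2 * m)%:R ^+ 4 *
  avg_sym m (fun a => avg_sym m (fun b => avg_sym m (fun c => avg_sym m (F a b c)))).
Proof.
move=> F0 m0.
apply: le_trans (avg_sym_zero (F := F 0 0 0) _ m0) _ => //.
rewrite exprS -[leRHS]mulrA ler_wpM2l//.
apply: le_trans (avg_sym_zero (F := fun c => avg_sym m (F 0 0 c)) _ m0) _.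
  by move=> c; apply: avg_sym_ge0.
rewrite exprS -[leRHS]mulrA ler_wpM2l//.
apply: le_trans (avg_sym_zero (F := fun b => avg_sym m (fun c => avg_sym m (F 0 b c))) _ m0) _.
  by move=> b; do 2 (apply: avg_sym_ge0 => ?).
rewrite exprS -[leRHS]mulrA ler_wpM2l// expr1.
apply: (avg_sym_zero (F := fun a => avg_sym m (fun b => avg_sym m (fun c => avg_sym m (F a b c))))) => //.
by move=> a; do 3 (apply: avg_sym_ge0 => ?).
Qed.

Lemma mder0 f x : mder 0 f x = (modulus (f x) ^+ 2)%:C%C.
Proof. by rewrite /mder addr0 mul_conj. Qed.

Lemma modulus_mder0 f x : modulus (mder 0 f x) = modulus (f x) ^+ 2.
Proof. by rewrite mder0 modulus_real ger0_norm// exprn_ge0 ?modulus_ge0. Qed.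

(** The zero shift in all four directions gives the mean of |f|^16. *)
Lemma autocorr_diagonal f : (\avg_x modulus (f x)) ^+ 16 <=
  autocorr (mder 0 (mder 0 (mder 0 f))) 0.
Proof.
apply: le_trans (avg_pow2_le 4 _) _; first by move=> x; exact: modulus_ge0.
rewrite /autocorr; under [X in modulus X]eq_avg do rewrite mder0 !modulus_mder0 -!exprM.
rewrite avg_realC modulus_real ger0_norm// avg_ge0// => x.
by rewrite exprn_ge0 ?modulus_ge0.
Qed.

Lemma quadratic_average_le_mean (M : nat) (g0 g1 f : G -> C) (o q : G) :
  bounded1 g0 -> bounded1 g1 ->
  modulus (\avg_(y < M) \avg_x (g0 x * g1 (x + o * y.+1%:R) *
      f (x + q * y.+1%:R ^+ 2))) <= \avg_x modulus (f x).
Proof.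
move=> b0 b1; have f0 : 0 <= \avg_x modulus (f x).
  by apply: avg_ge0 => x; exact: modulus_ge0.
apply: le_trans (modulus_avg _) _; apply: ler_avg_const => // y.
apply: le_trans (modulus_avg _) _.
rewrite [leRHS](avg_translate (q * y.+1%:R ^+ 2)); apply: ler_avg => x.
rewrite modulusM ler_piMl ?modulus_ge0//; exact: modulusM_le1.
Qed.
End Concatenating.

(** The range H of the auxiliary shifts is a small multiple of lam^4 M, which
    keeps the boundary errors 4 H / M and 6 H / M below the main terms lam and
    lam^4 / 16.  The three concatenation bounds are then unwound one after the
    other, and the interval of length H^2 is enlarged to one of length M^2. *)
Lemma group_quadratic_control (R : realType) : exists (c : R) (D : nat), 0 < c /\
  forall (G : finComNzRingType) (M : nat) (g0 g1 f : G -> R[i]) (o q : G)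
    (lam := modulus (\avg_(y < M) \avg_x (g0 x * g1 (x + o * y.+1%:R) *
      f (x + q * y.+1%:R ^+ 2)))),
  (0 < M)%N -> bounded1 g0 -> bounded1 g1 -> bounded1 f ->
  c * lam ^+ D <= cube_corr (16 * M ^ 2) (q * 2) f.
Proof.
have [c1 [D1 [c10 ext1]]] := @lower_bound_from_tradeoff R (27 ^+ 8 * 24) (27 ^+ 8 * 2 ^+ 18) 16 4
  ltac:(rewrite mulr_gt0 ?exprn_gt0//) ltac:(rewrite mulr_gt0 ?exprn_gt0//).
have [c2 [D2 [c20 ext2]]] := @lower_bound_from_tradeoff R 12 2 2 2 ltac:(done) ltac:(done).
pose w0 (l : R) := (l ^+ 4 / 32) ^+ 8.
pose low l := c2 * (c2 * (c1 * w0 l ^+ D1) ^+ D2) ^+ D2.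
pose c3 := c2 * (c2 * (c1 * (32^-1 ^+ 8) ^+ D1) ^+ D2) ^+ D2.
pose D3 := (4 * 8 * D1 * D2 * D2)%N.
have lowE l : low l = c3 * l ^+ D3.
  have pw (c x : R) m D : (c * x ^+ m) ^+ D = c ^+ D * x ^+ (m * D) by rewrite exprMn exprM.
  rewrite /low /w0 [_ / 32]mulrC (pw 32^-1) (pw (32^-1 ^+ 8)) (mulrA c1).
  by rewrite (pw (c1 * _)) (mulrA c2) (pw (c2 * _)) (mulrA c2).
have c30 : 0 < c3 by rewrite /c3; do ! (apply: mulr_gt0 || apply: exprn_gt0 || rewrite invr_gt0).
have [s [s0 s6 s8]] : exists s : R, [/\ 0 < s, 32 * (6 * s) <= 1 & 8 * s <= 1].
  have t0 : 0 < 32 * 6 :> R by exact: mulr_gt0.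
  exists (32 * 6)^-1; split; first by rewrite invr_gt0.
    by rewrite mulrA divff// gt_eqF.
  by rewrite ler_pdivrMr// mul1r; lra.
pose c4 := (s / 2) ^+ 8 * c3; pose c5 : R := (32 ^+ 4 * s^-1 ^+ 8)^-1.
have c40 : 0 < c4 by apply: mulr_gt0 => //; apply: exprn_gt0; exact: divr_gt0.
have c50 : 0 < c5.
  by rewrite invr_gt0; apply: mulr_gt0; apply: exprn_gt0; rewrite ?invr_gt0.
have mc4 : Num.min c4 c5 <= c4 by rewrite ge_min; apply/orP; left; exact: lexx.
have mc5 : Num.min c4 c5 <= c5 by rewrite ge_min; apply/orP; right; exact: lexx.
exists (Num.min c4 c5), (32 + D3 + 48)%N; split; first by rewrite lt_min; apply/andP; split.
move=> G M g0 g1 f o q lam M0 b0 b1 bf.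
have mn0 : 0 < M%:R :> R by rewrite ltr0n.
have lam0 : 0 <= lam by exact: modulus_ge0.
have lamf : lam <= \avg_x modulus (f x) by exact: quadratic_average_le_mean.
have lam1 : lam <= 1 by apply: le_trans lamf _; exact: ler_avg_const.
have cub0 := cube_corr_ge0 (16 * M ^ 2) (q * 2) f.
have [le0|lam_gt0] := leP lam 0.
  have -> : lam = 0 by apply/eqP; rewrite eq_le le0 lam0.
  by rewrite exprD [0 ^+ 48]expr0n !mulr0.
have wexp i j : (i <= j)%N -> lam ^+ j <= lam ^+ i.
  by move=> ij; apply: ler_wiXn2l.
have cD (c' : R) i : 0 < c' -> Num.min c4 c5 <= c' -> (i <= 32 + D3 + 48)%N ->
    Num.min c4 c5 * lam ^+ (32 + D3 + 48) <= c' * lam ^+ i.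
  move=> c'0 cc' hi; apply: ler_pM; rewrite ?exprn_ge0 ?wexp//.
  by rewrite le_min; apply/andP; split; exact: ltW.
pose H := Num.truncn (lam ^+ 4 * M%:R * s).
have l4 : 0 <= lam ^+ 4 by exact: exprn_ge0.
have y0 : 0 <= lam ^+ 4 * M%:R * s by rewrite !mulr_ge0 ?exprn_ge0// ltW.
have Hle : H%:R <= lam ^+ 4 * M%:R * s by rewrite /H truncn_le.
have Hgt : lam ^+ 4 * M%:R * s < H%:R + 1 by rewrite natr1 /H truncnS_gt.
have [H0|H0] := posnP H.
  (* No room for shifts: then M is at most a power of 1 / lam, so the number
     of quadruples k is too, and the term k = 0 already has the right size. *)
  apply: le_trans (cD c5 48%N c50 mc5 _) _; first by rewrite leq_addl.
  rewrite H0 add0r -ltr_pdivlMr// mul1r in Hgt.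
  have L0 : (0 < 16 * M ^ 2)%N by rewrite muln_gt0 expn_gt0 M0.
  have := @avg_sym_cube_zero _ (16 * M ^ 2) (fun k1 k2 k3 k4 =>
    autocorr (mder (q * 2 * k3%:~R) (mder (q * 2 * k2%:~R) (mder (q * 2 * k1%:~R) f)))
     (q * 2 * k4%:~R)) _ L0.
  rewrite -/(cube_corr _ _ _) !mulr0 => /(_ (fun _ _ _ _ => autocorr_ge0 _ _)) hz.
  have h16 : lam ^+ 16 <= (2 * (16 * M ^ 2))%:R ^+ 4 * cube_corr (16 * M ^ 2) (q * 2) f.
    apply: le_trans hz; apply: le_trans (autocorr_diagonal f); exact: ler_expr_nonneg.
  have hM : (2 * (16 * M ^ 2))%:R ^+ 4 * lam ^+ 32 <= c5^-1.
    have -> : (2 * (16 * M ^ 2))%:R ^+ 4 * lam ^+ 32 = 32 ^+ 4 * (lam ^+ 4 * M%:R) ^+ 8 :> R.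
      rewrite -mulnn !natrM; ring.
    rewrite /c5 invrK ler_wpM2l ?exprn_ge0//; apply: ler_expr_nonneg; last exact: ltW.
    by rewrite mulr_ge0 ?exprn_ge0.
  rewrite mulrC -ler_pdivlMr// mulrC.
  apply: (le_trans (y := (2 * (16 * M ^ 2))%:R ^+ 4 * lam ^+ 32 * cube_corr (16 * M ^ 2) (q * 2) f)).
    rewrite mulrAC (_ : lam ^+ 48 = lam ^+ 16 * lam ^+ 32); last by rewrite -exprD.
    by rewrite ler_wpM2r ?exprn_ge0.
  by rewrite ler_wpM2r.
apply: le_trans (cD c4 (32 + D3)%N c40 mc4 _) _; first by rewrite leq_addr.
have Hn0 : 0 < H%:R :> R by rewrite ltr0n.
have H1 : 1 <= H%:R :> R by rewrite ler1n.
have l41 : lam ^+ 4 <= lam by apply: (wexp 1%N 4%N).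
have l40 : 0 < lam ^+ 4 by rewrite exprn_gt0.
have HM : lam ^+ 4 * (s / 2) <= H%:R / M%:R by rewrite ler_pdivlMr//; lra.
have HM1 : H%:R / M%:R <= lam ^+ 4 * s by rewrite ler_pdivrMr// mulrAC.
have e6s : 32 * (6 * (lam ^+ 4 * s)) <= lam ^+ 4.
  have -> : 32 * (6 * (lam ^+ 4 * s)) = lam ^+ 4 * (32 * (6 * s)) by ring.
  by rewrite ler_piMr.
have e8s : 8 * (lam ^+ 4 * s) <= lam.
  have -> : 8 * (lam ^+ 4 * s) = lam ^+ 4 * (8 * s) by ring.
  by apply: le_trans l41; rewrite ler_piMr.
have HleM : (H <= M)%N.
  have : H%:R / M%:R <= 1 :> R by lra.
  by rewrite ler_pdivrMr// mul1r ler_nat.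
pose w := linear_average H (q * 2) f.
have ww0 : w0 lam <= w.
  apply: le_trans (linearisation M o q H0 b0 b1 bf); rewrite -/lam /w0.
  apply: ler_expr_nonneg; first by rewrite divr_ge0// ltW.
  rewrite le_max; apply/orP; right.
  have e4 : (4 * H)%:R / M%:R = 4 * (H%:R / M%:R) :> R by rewrite natrM mulrA.
  have e6 : (6 * H)%:R / M%:R = 6 * (H%:R / M%:R) :> R by rewrite natrM mulrA.
  rewrite e4 e6; have h2 : lam / 2 <= Num.max 0 (lam - 4 * (H%:R / M%:R)).
    by rewrite le_max; apply/orP; right; lra.
  have h3 : (lam / 2) ^+ 4 <= Num.max 0 (lam - 4 * (H%:R / M%:R)) ^+ 4.
    by apply: ler_expr_nonneg => //; rewrite divr_ge0.
  have h4 : (lam / 2) ^+ 4 = lam ^+ 4 / 16 by field.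
  lra.
have w00 : 0 < w0 lam by rewrite /w0 exprn_gt0// divr_gt0.
have w_gt0 : 0 < w by exact: lt_le_trans ww0.
have st1 : c1 * w ^+ D1 <= mixed_corr H (q * 2) f.
  apply: ext1; first by rewrite w_gt0 linear_average_le1.
  by move=> K K0; exact: linear_average_le.
have mx0 : 0 < mixed_corr H (q * 2) f.
  by apply: lt_le_trans st1; rewrite mulr_gt0// exprn_gt0.
have st2 : c2 * mixed_corr H (q * 2) f ^+ D2 <= semimixed_corr H (q * 2) f.
  apply: ext2; first by rewrite mx0 mixed_corr_le1.
  by move=> K K0; exact: mixed_corr_le.
have sm0 : 0 < semimixed_corr H (q * 2) f.
  by apply: lt_le_trans st2; rewrite mulr_gt0// exprn_gt0.
have st3 : c2 * semimixed_corr H (q * 2) f ^+ D2 <= cube_corr (16 * H ^ 2) (q * 2) f.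
  apply: ext2; first by rewrite sm0 semimixed_corr_le1.
  by move=> K K0; exact: semimixed_corr_le.
have lowH : c3 * lam ^+ D3 <= cube_corr (16 * H ^ 2) (q * 2) f.
  rewrite -lowE /low; apply: le_trans st3; apply: ler_wpM2l; first exact: ltW.
  apply: ler_expr_nonneg; first by rewrite ltW// mulr_gt0// exprn_gt0// mulr_gt0// exprn_gt0.
  apply: le_trans st2; apply: ler_wpM2l; first exact: ltW.
  apply: ler_expr_nonneg; first by rewrite ltW// mulr_gt0// exprn_gt0.
  apply: le_trans st1; apply: ler_wpM2l; first exact: ltW.
  by apply: ler_expr_nonneg => //; exact: ltW.
have sub : cube_corr (16 * H ^ 2) (q * 2) f <=
    (M%:R / H%:R) ^+ 8 * cube_corr (16 * M ^ 2) (q * 2) f.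
  apply: le_trans (@avg_sym_cube_sub _ (16 * H ^ 2) (16 * M ^ 2) _ _ _) _.
  - by move=> *; exact: autocorr_ge0.
  - by rewrite muln_gt0 expn_gt0 H0 leq_mul2l leq_exp2r.
  - rewrite -/(cube_corr _ _ _) ler_wpM2r// -!mulnn !natrM le_eqVlt; apply/orP; left.
    by apply/eqP; field; rewrite gt_eqF.
have {}sub : c3 * lam ^+ D3 * (H%:R / M%:R) ^+ 8 <= cube_corr (16 * M ^ 2) (q * 2) f.
  have e8 : (H%:R / M%:R) ^+ 8 * (M%:R / H%:R) ^+ 8 = 1 :> R.
    by field; rewrite !gt_eqF.
  move: e8; set u := (H%:R / M%:R) ^+ 8; set v := (M%:R / H%:R) ^+ 8 => e8.
  have u0 : 0 <= u by rewrite exprn_ge0// divr_ge0.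
  apply: le_trans (ler_wpM2r u0 (le_trans lowH sub)) _.
  by rewrite -/v mulrAC [v * u]mulrC e8 mul1r.
apply: le_trans sub; rewrite exprD /c4.
have -> : (s / 2) ^+ 8 * c3 * (lam ^+ 32 * lam ^+ D3) =
   c3 * lam ^+ D3 * (lam ^+ 4 * (s / 2)) ^+ 8 by rewrite [in RHS]exprMn -exprM; ring.
apply: ler_wpM2l; first by apply: mulr_ge0; [exact: ltW|exact: exprn_ge0].
apply: ler_expr_nonneg => //; apply: mulr_ge0; first exact: ltW.
by rewrite divr_ge0// ltW.
Qed.

(** * The Gowers norm as a sum of squares *)
Local Open Scope classical_set_scope.
Local Open Scope ring_scope.

Section FiniteSupport.

Lemma fsbig_sub_seq (T : choiceType) (V : nmodType) (P : set T) (r : seq T) (F : T -> V) :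
  uniq r -> (forall i, i \in r -> P i) -> (forall i, P i -> i \notin r -> F i = 0) ->
  \sum_(i \in P) F i = \sum_(i <- r) F i.
Proof.
move=> ur rP Fr; rewrite [RHS]fsbig_seq//; apply/esym.
apply: (fsbig_widen [set` r] P F) => //.
by move=> i [Pi /= /negP ir]; exact: Fr.
Qed.

Lemma fsbig_setT_seq (T : choiceType) (V : nmodType) (r : seq T) (F : T -> V) :
  uniq r -> (forall i, i \notin r -> F i = 0) ->
  \sum_(i \in [set: T]) F i = \sum_(i <- r) F i.
Proof. by move=> ur Fr; apply: fsbig_sub_seq => // i _; exact: Fr. Qed.

Lemma sum_tuple_cons (T : finType) (V : nmodType) (s : nat) (F : s.+1.-tuple T -> V) :
  \sum_t F t = \sum_(a : T) \sum_(t : s.-tuple T) F [tuple of a :: t].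
Proof.
rewrite pair_big /= (reindex (fun p : T * s.-tuple T => [tuple of p.1 :: p.2])) //=.
exists (fun t : s.+1.-tuple T => (thead t, [tuple of behead t])).
  by move=> [a t] _; congr (_, _); apply: val_inj.
by move=> t _; rewrite /= [RHS]tuple_eta.
Qed.

Definition shift_ord (P : nat) (i : 'I_(2 * P).+1) : int := (i : nat)%:Z - P%:Z.

Lemma shift_ord_inj P : injective (@shift_ord P).
Proof. by move=> i j; rewrite /shift_ord => h; apply: val_inj => /=; lia. Qed.

Lemma sum_int_window (V : nmodType) (P : nat) (F : int -> V) :
  (forall x, ~~ (`|x| <= P)%N -> F x = 0) ->
  \sum_(x \in [set: int]) F x = \sum_(i < (2 * P).+1) F (shift_ord i).
Proof.
move=> F0; rewrite (@fsbig_setT_seq _ _ [seq shift_ord i | i : 'I_(2 * P).+1]).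
- by rewrite big_image.
- by rewrite map_inj_uniq ?enum_uniq//; exact: shift_ord_inj.
- move=> x xr; apply: F0; apply: contra xr => xP; apply/fintype.imageP.
  have lt_x : (`|(x + P%:Z)%R| < (2 * P).+1)%N by lia.
  by exists (Ordinal lt_x) => //; rewrite /shift_ord /=; lia.
Qed.

Lemma sum_tuple_window (V : nmodType) (P s : nat) (F : s.-tuple int -> V) :
  (forall h : s.-tuple int, ~~ all (fun x : int => `|x| <= P)%N h -> F h = 0) ->
  \sum_(h \in [set: s.-tuple int]) F h =
  \sum_(t : s.-tuple 'I_(2 * P).+1) F (map_tuple (@shift_ord P) t).
Proof.
move=> F0; rewrite (@fsbig_setT_seq _ _ [seq map_tuple (@shift_ord P) t | t : s.-tuple 'I_(2 * P).+1]).
- by rewrite big_image.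
- rewrite map_inj_uniq ?enum_uniq// => t t' /(congr1 val) /= /inj_map h.
  by apply: val_inj; apply: h; exact: shift_ord_inj.
- move=> h hr; apply: F0; apply: contra hr => /allP hP; apply/fintype.imageP.
  have lt_x (x : int) : (`|x| <= P)%N -> (`|(x + P%:Z)%R| < (2 * P).+1)%N by lia.
  exists (map_tuple (fun x : int => inord `|(x + P%:Z)%R|) h) => //.
  apply: val_inj; rewrite /= -map_comp -[LHS]map_id; apply/eq_in_map => x /hP xP.
  by rewrite /shift_ord /= inordK ?lt_x//; lia.
Qed.
End FiniteSupport.

Section MulDiffs.
Variable R : realType.
Local Notation C := R[i].
Implicit Types (f : int -> C) (h : seq int).

Lemma mul_diffs_neq0 h f x : mul_diffs h f x != 0 ->
  f x != 0 /\ {in h, forall a, f (x + a) != 0}.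
Proof.
elim: h x => [|a h IHh] x //=; rewrite /mul_diff mulf_eq0 negb_or conjC_eq0.
move=> /andP[/IHh[fx fh] /IHh[fxa _]]; split=> // b; rewrite inE => /predU1P[->//|].
exact: fh.
Qed.

Definition int_sum (f : int -> C) : C := \sum_(x \in [set: int]) f x.

Lemma supported_window N P f x : supported_in f (initial_segment N) -> (N <= P)%N ->
  ~~ (`|x| <= P)%N -> f x = 0.
Proof. by move=> sf NP xP; apply: sf; rewrite /initial_segment /=; lia. Qed.

Lemma supported_neq0 N f x : supported_in f (initial_segment N) -> f x != 0 -> 1 <= x <= N%:Z.
Proof. by move=> sf; apply: contra_neqT => h; apply: sf => /= h'; rewrite h' in h. Qed.

Lemma supported_mul_diffs N f h : supported_in f (initial_segment N) ->
  supported_in (mul_diffs h f) (initial_segment N).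
Proof.
move=> sf x nx; apply/eqP/negPn; apply/negP => /mul_diffs_neq0[fx _].
by apply: nx; exact: supported_neq0 fx.
Qed.

Lemma mul_diffs_window N P f h x : supported_in f (initial_segment N) -> (N <= P)%N ->
  ~~ all (fun a : int => `|a| <= P)%N h -> mul_diffs h f x = 0.
Proof.
move=> sf NP; apply: contraNeq => /mul_diffs_neq0[fx fh]; apply/allP => a /fh fxa.
by have := supported_neq0 sf fx; have := supported_neq0 sf fxa; lia.
Qed.

Lemma int_sum_shift f a : int_sum (fun x => f (a + x)) = int_sum f.
Proof.
by rewrite /int_sum [RHS](reindex_fsbigT (fun x => a + x) f).
Qed.

(** The head of a tuple is the outermost difference, and summing
    g(x) conj g(x + a) over x and a gives the square of |sum_x g(x)|. *)
Lemma gowers_sum_squares N P f : supported_in f (initial_segment N) -> (N <= P)%N ->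
  \sum_(x \in [set: int]) \sum_(h \in [set: 5.-tuple int]) mul_diffs h f x =
  (\sum_(t : 4.-tuple 'I_(2 * P).+1)
    modulus (int_sum (mul_diffs (map (@shift_ord P) t) f)) ^+ 2)%:C%C.
Proof.
move=> sf NP.
transitivity (\sum_(x \in [set: int]) \sum_(t : 4.-tuple 'I_(2 * P).+1)
   (mul_diffs (map (@shift_ord P) t) f x *
    (int_sum (mul_diffs (map (@shift_ord P) t) f))^*)).
  apply: eq_fsbigr => x _; rewrite (@sum_tuple_window _ P) => [|h]; last first.
    exact: mul_diffs_window sf NP.
  rewrite sum_tuple_cons exchange_big /=; apply: eq_bigr => t _.
  set g := mul_diffs (map (@shift_ord P) t) f.
  rewrite /mul_diff -mulr_sumr; have [->|gx] := eqVneq (g x) 0; first by rewrite !mul0r.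
  congr (_ * _); rewrite -rmorph_sum; congr (_^*).
  rewrite -(int_sum_shift g x) /int_sum (@sum_int_window _ P)// => a aP.
  have sg : supported_in g (initial_segment N) by exact: supported_mul_diffs.
  apply: sg => /= xa; have := supported_neq0 (@supported_mul_diffs _ _ _ sf) gx.
  by move: aP xa; rewrite /initial_segment /=; lia.
rewrite (@sum_int_window _ P) => [|x xP]; last first.
  apply: big1 => t _; rewrite (supported_window (@supported_mul_diffs _ _ _ sf) NP xP).
  by rewrite mul0r.
rewrite exchange_big rmorph_sum; apply: eq_bigr => t _.
rewrite -mulr_suml -(@sum_int_window _ P (mul_diffs (map (@shift_ord P) t) f)); last first.
  by move=> x xP; exact: (supported_window (@supported_mul_diffs _ _ _ sf) NP xP).
by rewrite -/(int_sum _) mul_conj.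
Qed.

Lemma gowers_norm5E N P f : supported_in f (initial_segment N) -> (N <= P)%N ->
  gowers_norm 5 f ^+ (2 ^ 5) = \sum_(t : 4.-tuple 'I_(2 * P).+1)
    modulus (int_sum (mul_diffs (map (@shift_ord P) t) f)) ^+ 2.
Proof.
move=> sf NP; rewrite /gowers_norm (gowers_sum_squares sf NP) /=.
rewrite -powR_mulrn ?powR_ge0// -powRrM mulVf ?pnatr_eq0//.
by rewrite powRr1// sumr_ge0// => t _; rewrite exprn_ge0 ?modulus_ge0.
Qed.

End MulDiffs.

(** * Residue classes *)
Section Residues.
Variable R : realType.
Local Notation C := R[i].
Implicit Types (f : int -> C) (h : seq int).

Lemma sum_sqr_le (I : finType) (a : I -> R) :
  (\sum_i a i) ^+ 2 <= #|I|%:R * \sum_i a i ^+ 2.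
Proof.
have [I0|I0] := posnP #|I|.
  by rewrite I0 mul0r (big_pred0 _ _ _ _ (fun i => _)) ?expr0n// => i;
     have := fintype0 i I0.
have := avg_sqr_le a; rewrite /avg => h.
have n0 : 0 < #|I|%:R :> R by rewrite ltr0n.
have := ler_wpM2l (exprn_ge0 2 (ltW n0)) h.
set n := #|I|%:R in n0 *; set s := \sum_i a i; set t := \sum_i _.
have -> : n ^+ 2 * (s / n) ^+ 2 = s ^+ 2 by field; rewrite gt_eqF.
by have -> : n ^+ 2 * (t / n) = n * t by field; rewrite gt_eqF.
Qed.

Definition restrict (q u : nat) f : int -> C :=
  fun x => f x * indicator R (residue_class u%:Z q) x.

Lemma indicator_residue (q u : nat) (x : int) :
  indicator R (residue_class u%:Z q) x = (q%:Z %| x - u%:Z)%Z%:R.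
Proof.
rewrite /indicator indicE; congr (_%:R); congr nat_of_bool.
apply/idP/idP => [/set_mem[k _ <-]|/dvdzP[k xu]].
  by rewrite addrAC subrr add0r dvdz_mulr.
by apply/mem_set; exists k => //; rewrite mulrC -xu addrC subrK.
Qed.

(** Shifts by multiples of q do not leave a residue class. *)
Lemma mul_diffs_restrict q u f h x : all (fun a => (q%:Z %| a)%Z) h ->
  mul_diffs h (restrict q u f) x = mul_diffs h f x * (q%:Z %| x - u%:Z)%Z%:R.
Proof.
elim: h x => [|a h IHh] x /=; first by rewrite /restrict indicator_residue.
move=> /andP[qa qh]; rewrite /mul_diff !IHh// rmorphM rmorph_nat.
have -> : (q%:Z %| x + a - u%:Z)%Z = (q%:Z %| x - u%:Z)%Z.
  by rewrite addrAC rpredDr.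
by case: (_ %| _)%Z; rewrite ?mulr1 ?mulr0 ?mul0r.
Qed.

Lemma sum_residues (q : nat) (x : int) : (0 < q)%N ->
  \sum_(1 <= u < q.+1) (q%:Z %| x - u%:Z)%Z%:R = 1 :> C.
Proof.
move=> q0; rewrite big_add1 /= big_mkord.
have lt_r : (`|((x - 1) %% q%:Z)%Z| < q)%N.
  have := ltz_pmod (x - 1) (_ : 0 < q%:Z); have := modz_ge0 (x - 1) (_ : q%:Z != 0).
  lia.
have rE : (`|((x - 1) %% q%:Z)%Z|%N%:Z) = ((x - 1) %% q%:Z)%Z.
  by rewrite gez0_abs// modz_ge0//; lia.
rewrite (bigD1 (Ordinal lt_r)) //= big1 ?addr0.
  rewrite (_ : (_ %| _)%Z) //.
  have -> : x - (`|((x - 1) %% q%:Z)%Z|.+1)%:Z = (x - 1) - ((x - 1) %% q%:Z)%Z by lia.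
  by rewrite {1}(divz_eq (x - 1) q%:Z) addrK dvdz_mull.
move=> i /negP ne; case: (boolP (q%:Z %| x - i.+1%:Z)%Z) => // /dvdzP[k xk].
case: ne; apply/eqP/val_inj => /=.
have -> : x - 1 = k * q%:Z + (i : nat)%:Z by lia.
by rewrite modzMDl modz_small//=; move: (ltn_ord i); lia.
Qed.

Lemma supported_restrict N q u f : supported_in f (initial_segment N) ->
  supported_in (restrict q u f) (initial_segment N).
Proof. by move=> sf x nx; rewrite /restrict sf// mul0r. Qed.

Lemma int_sum_window N P f : supported_in f (initial_segment N) -> (N <= P)%N ->
  int_sum f = \sum_(i < (2 * P).+1) f (shift_ord i).
Proof.
move=> sf NP; rewrite /int_sum (@sum_int_window _ P)// => x xP.
exact: supported_window sf NP xP.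
Qed.

Lemma int_sum_residues N q f h : (0 < q)%N -> supported_in f (initial_segment N) ->
  all (fun a => (q%:Z %| a)%Z) h ->
  int_sum (mul_diffs h f) = \sum_(1 <= u < q.+1) int_sum (mul_diffs h (restrict q u f)).
Proof.
move=> q0 sf qh.
rewrite (int_sum_window (@supported_mul_diffs _ _ _ _ sf) (leqnn N)).
under [RHS]eq_bigr => u _ do rewrite
  (int_sum_window (@supported_mul_diffs _ _ _ _ (@supported_restrict _ q u _ sf)) (leqnn N)).
rewrite exchange_big /=; apply: eq_bigr => i _.
under eq_bigr do rewrite mul_diffs_restrict//.
by rewrite -mulr_sumr sum_residues// mulr1.
Qed.

(** Cauchy-Schwarz over the q residue classes. *)
Lemma modulus_int_sum_sqr N q f h : (0 < q)%N -> supported_in f (initial_segment N) ->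
  all (fun a => (q%:Z %| a)%Z) h ->
  modulus (int_sum (mul_diffs h f)) ^+ 2 <= q%:R *
    \sum_(1 <= u < q.+1) modulus (int_sum (mul_diffs h (restrict q u f))) ^+ 2.
Proof.
move=> q0 sf qh; rewrite (int_sum_residues q0 sf qh) !big_add1 /= !big_mkord.
apply: le_trans (ler_expr_nonneg 2 (modulus_ge0 _) (ler_modulus_sum _ _)) _.
by apply: le_trans (sum_sqr_le _) _; rewrite card_ord.
Qed.

Lemma sum_tuple_prod (T : finType) (s : nat) (b : T -> R) :
  \sum_(t : s.-tuple T) \prod_(k <- t) b k = (\sum_k b k) ^+ s.
Proof.
elim: s => [|s IHs].
  rewrite (big_pred1 ([tuple] : 0.-tuple T)) ?big_nil// => t.
  by apply/esym/eqP; exact: tuple0.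
rewrite sum_tuple_cons exprS mulr_suml; apply: eq_bigr => a _.
by rewrite -IHs mulr_sumr; apply: eq_bigr => t _; rewrite big_cons.
Qed.

Lemma modulus_mul_diffs_le1 f h : bounded1 f -> bounded1 (mul_diffs h f).
Proof.
by move=> f1; elim: h => //= a h IHh x; apply: modulusM_le1; rewrite ?modulus_conj.
Qed.

Lemma bounded1_nat_of_bool (b : bool) : modulus (b%:R : C) <= 1.
Proof. by case: b; rewrite ?modulus1 ?modulus0. Qed.

Lemma bounded1_indicator S : bounded1 (indicator R S).
Proof. by move=> x; rewrite /indicator indicE; exact: bounded1_nat_of_bool. Qed.

Lemma supported_one N : supported_in (indicator R (initial_segment N)) (initial_segment N).
Proof.
by move=> x nx; rewrite /indicator indicE memNset.
Qed.

(** The sum over x has at most 4 N / q terms, and it vanishes unless all four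
    entries of h are multiples of q in [-N, N], which leaves at most
    4 N / q choices for each of them. *)
Lemma local_gowers_one_le N q u : (0 < q <= N)%N ->
  local_gowers_norm 5 (residue_class u%:Z q) (indicator R (initial_segment N)) ^+ (2 ^ 5)
  <= (4 * (N%:R / q%:R)) ^+ 6 :> R.
Proof.
move=> /andP[q0 qN]; rewrite /local_gowers_norm -/(restrict q u (indicator R (initial_segment N))).
have sg := @supported_restrict N q u _ (@supported_one N).
set g := restrict q u (indicator R (initial_segment N)) in sg *.
rewrite (gowers_norm5E sg (leqnn N)).
pose n := (2 * N).+1; pose b (k : 'I_n) : R := (q%:Z %| shift_ord k)%Z%:R.
pose a (k : 'I_n) : R := (q%:Z %| shift_ord k - u%:Z)%Z%:R.
have g1 : bounded1 g.
  move=> x; apply: modulusM_le1; first exact: bounded1_indicator.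
  exact: bounded1_indicator.
have gq x : g x != 0 -> (q%:Z %| x - u%:Z)%Z.
  rewrite /g /restrict indicator_residue.
  by case: (_ %| _)%Z => //; rewrite mulr0 eqxx.
have b01 k : 0 <= b k <= 1 by rewrite /b; case: (_ %| _)%Z; rewrite ?lexx ?ler01.
have cnt (c : int) : \sum_(k : 'I_n) ((q%:Z %| shift_ord k + c)%Z%:R : R) <= 4 * (N%:R / q%:R).
  have -> : \sum_(k : 'I_n) ((q%:Z %| shift_ord k + c)%Z%:R : R) =
      #|[set i : 'I_n | (q %| `|((c - N%:Z) + (i : nat)%:Z)%R|)%N]%SET|%:R.
    rewrite -sum1_card natr_sum [RHS]big_mkcond /=; apply: eq_bigr => k _; rewrite inE.
    have -> : c - N%:Z + (k : nat)%:Z = shift_ord k + c by rewrite /shift_ord; ring.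
    by rewrite -[X in (X %| _)%N]/`|q%:Z|%N -dvdzE; case: (_ %| _)%Z.
  apply: (le_trans (y := ((n %/ q).+1)%:R)); first by rewrite ler_nat card_multiples.
  rewrite mulrA ler_pdivlMr ?ltr0n// -!natrM ler_nat.
  by have := leq_trunc_div n q; rewrite /n mulSn; lia.
have Zb (t : 4.-tuple 'I_n) :
    modulus (int_sum (mul_diffs (map (@shift_ord N) t) g)) <=
    4 * (N%:R / q%:R) * \prod_(k <- t) b k.
  rewrite (int_sum_window (@supported_mul_diffs _ _ _ _ sg) (leqnn N)).
  apply: le_trans (ler_modulus_sum _ _) _.
  apply: (le_trans (y := \sum_k a k * \prod_(k <- t) b k)); last first.
    rewrite -mulr_suml; apply: ler_wpM2r; last exact: cnt.
    by apply: prodr_ge0 => k _; have /andP[] := b01 k.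
  apply: ler_sum => k _.
  set z := mul_diffs _ _ _; have [->|z0] := eqVneq z 0.
    rewrite modulus0; apply: mulr_ge0; first exact: ler0n.
    by apply: prodr_ge0 => j _; have /andP[] := b01 j.
  have [gk gt] := mul_diffs_neq0 z0.
  rewrite /a gq// mul1r big1_seq; first exact: modulus_mul_diffs_le1.
  move=> j /= jt; rewrite /b.
  have /gq h1 : g (shift_ord k + shift_ord j) != 0 by apply: gt; exact: map_f.
  have h2 := gq _ gk.
  have -> : shift_ord j = (shift_ord k + shift_ord j - u%:Z) - (shift_ord k - u%:Z) by ring.
  by rewrite rpredB.
have X0 : 0 <= 4 * (N%:R / q%:R) :> R by rewrite mulr_ge0 ?divr_ge0.
apply: (le_trans (y := \sum_(t : 4.-tuple 'I_n) (4 * (N%:R / q%:R)) ^+ 2 * \prod_(k <- t) b k)).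
  apply: ler_sum => t _; apply: le_trans (ler_expr_nonneg 2 (modulus_ge0 _) (Zb t)) _.
  have /andP[p0 p1] : 0 <= \prod_(k <- t) b k <= 1.
    apply: (big_ind (fun x => 0 <= x <= 1)) => [|x y /andP[x0 x1] /andP[y0 y1]|//].
      by rewrite ler01 lexx.
    by rewrite mulr_ge0//= mulr_ile1.
  by rewrite exprMn ler_wpM2l ?exprn_ge0// expr2 ler_piMr.
rewrite -mulr_sumr sum_tuple_prod.
have s0 : 0 <= \sum_k b k by apply: sumr_ge0 => k _; have /andP[] := b01 k.
have sb : \sum_k b k <= 4 * (N%:R / q%:R).
  by have := cnt 0; under eq_bigr do rewrite addr0.
apply: le_trans (ler_wpM2l (exprn_ge0 2 X0) (ler_expr_nonneg 4 s0 sb)) _.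
by rewrite -exprD.
Qed.
End Residues.

(** * Passage to a cyclic group *)
Section Embedding.
Variables (R : realType) (w N : nat).
Local Notation C := R[i].
Local Notation W := w.+2.
Local Notation G := ('I_w.+2 : finComNzRingType).
Implicit Types (f g : int -> C) (h : seq int).

(** Only values of the argument in the range 0, ..., W - 1 are seen, so f should
    be supported in an interval much shorter than W. *)
Definition periodise f : 'I_W -> C := fun x => f (x : nat)%:Z.

Lemma modulus_one_bounded f : one_bounded f -> bounded1 f.
Proof. by move=> f1 x; rewrite modulus_le rmorph1. Qed.

(** A negative a is represented by a + W, which lies beyond the support. *)
Lemma periodiseE f (a : int) : supported_in f (initial_segment N) ->
  N%:Z - W%:Z < a < W%:Z -> periodise f a%:~R = f a.
Proof.
move=> sf; rewrite /periodise.
have natE n : (n < W)%N -> ((n%:R : 'I_W) : nat) = n.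
  by move=> nW; rewrite Zp_nat /= modn_small.
case: (lerP 0 a) => a0 /andP[a1 a2].
  have -> : a%:~R = (`|a|%N)%:R :> 'I_W by rewrite -[in LHS](gez0_abs a0).
  by rewrite natE; [rewrite gez0_abs|lia].
have WR : (W%:R : 'I_W) = 0 by rewrite Zp_nat; apply: val_inj; rewrite /= modnn.
have -> : a%:~R = (`|(a + W%:Z)%R|%N)%:R :> 'I_W.
  have -> : (`|(a + W%:Z)%R|%N)%:R = (a + W%:Z)%:~R :> 'I_W.
    by rewrite -[in RHS](@gez0_abs (a + W%:Z))//; lia.
  by rewrite intrD -[W%:Z%:~R]/(W%:R) WR addr0.
rewrite natE; last by lia.
by rewrite !sf//; rewrite /initial_segment /=; lia.
Qed.

Definition abs_sum h : nat := sumn (map absz h).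

(** No wrap-around occurs when the shifts are small in total. *)
Lemma mder_periodise f h (a : int) : supported_in f (initial_segment N) ->
  N%:Z - W%:Z + (abs_sum h)%:Z < a < W%:Z - (abs_sum h)%:Z ->
  foldr (fun k : int => mder (k%:~R : G)) (periodise f) h a%:~R = mul_diffs h f a.
Proof.
move=> sf; elim: h a => [|k h IHh] a /=.
  by rewrite /abs_sum /= => ha; apply: periodiseE => //; lia.
rewrite /abs_sum /= -/(abs_sum h) => ha; rewrite /mder /mul_diff -intrD !IHh//; lia.
Qed.

Lemma mder_eq0 f h (x : G) : periodise f x = 0 ->
  foldr (fun k : int => mder (k%:~R : G)) (periodise f) h x = 0.
Proof. by move=> fx; elim: h => //= k h IHh; rewrite /mder IHh mul0r. Qed.

Lemma sum_periodise (F : int -> C) : (N < W)%N ->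
  (forall x, ~~ (1 <= x <= N%:Z) -> F x = 0) ->
  \sum_(x \in [set: int]) F x = \sum_(x : 'I_W) F (x : nat)%:Z.
Proof.
move=> NW F0; rewrite (@fsbig_setT_seq _ _ [seq (x : nat)%:Z | x : 'I_W]).
- by rewrite big_image.
- by rewrite map_inj_uniq ?enum_uniq// => i j [ij]; apply: val_inj.
- move=> x xr; apply: F0; apply: contra xr => xN; apply/fintype.imageP.
  have lt_x : (`|x| < W)%N by lia.
  by exists (Ordinal lt_x) => //=; lia.
Qed.

Lemma natr_ord_val (x : 'I_W) : x = (x : nat)%:Z%:~R.
Proof. by apply: val_inj; rewrite -[_%:~R]/((x : nat)%:R) Zp_nat /= modn_small. Qed.

Lemma int_sum_mul_diffs f h : supported_in f (initial_segment N) ->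
  (N + abs_sum h < w)%N ->
  int_sum (mul_diffs h f) =
  \sum_(x : G) foldr (fun k : int => mder (k%:~R : G)) (periodise f) h x.
Proof.
move=> sf hw; rewrite /int_sum sum_periodise; last first.
- move=> x xN; apply: (@supported_mul_diffs _ _ _ h sf).
  by rewrite /initial_segment /=; apply/negP.
- by lia.
apply: eq_bigr => x _; have [xN|xN] := leqP x N.
  by rewrite [in RHS](natr_ord_val x) mder_periodise//; lia.
rewrite mder_eq0; last by rewrite /periodise sf// /initial_segment /=; lia.
by rewrite (@supported_mul_diffs _ _ _ h sf)// /initial_segment /=; lia.
Qed.

(** The support of g0 and f forces q y^2 < N, hence y <= M, and all arguments
    stay below 2 N. *)
Lemma quadratic_count_periodise (q M : nat) g0 g1 f :
  supported_in g0 (initial_segment N) -> supported_in g1 (initial_segment N) ->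
  supported_in f (initial_segment N) -> (0 < q)%N -> (N < q * M.+1 ^ 2)%N ->
  (q * M ^ 2 <= N)%N -> (N + N < w)%N ->
  quadratic_count q g0 g1 f = \sum_(x : G) \sum_(y < M)
    (periodise g0 x * periodise g1 (x + 1 * y.+1%:R) *
     periodise f (x + q%:R * y.+1%:R ^+ 2)).
Proof.
move=> s0 s1 sf q0 NM MN Nw; rewrite /quadratic_count sum_periodise; last first.
- move=> x xN; apply: fsbig1 => y _.
  by rewrite s0 ?mul0r// /initial_segment /=; apply/negP.
- by lia.
have leMN : (M <= N)%N by apply: leq_trans MN; rewrite -mulnn; nia.
apply: eq_bigr => x _; rewrite {1}/periodise.
have [g0x|g0x] := eqVneq (g0 (x : nat)%:Z) 0.
  rewrite fsbig1 ?big1// => [y _|y _]; first by rewrite g0x !mul0r.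
  by rewrite g0x !mul0r.
have xN := supported_neq0 s0 g0x.
pose F (y : nat) := g0 (x : nat)%:Z * g1 ((x : nat)%:Z + y%:Z) *
  f ((x : nat)%:Z + q%:Z * y%:Z ^+ 2).
have ur : uniq [seq y.+1 | y : 'I_M].
  by rewrite map_inj_uniq ?enum_uniq// => i j [ij]; apply: val_inj.
transitivity (\sum_(y <- [seq y.+1 | y : 'I_M]) F y).
  apply: fsbig_sub_seq => //; first by move=> y /fintype.imageP[i _ ->].
  move=> y /= y0 yr; rewrite /F sf ?mulr0// /initial_segment /=.
  have yM : (M < y)%N.
    rewrite ltnNge; apply: contra yr => yM; apply/fintype.imageP.
    have lt_y : (y.-1 < M)%N by lia.
    by exists (Ordinal lt_y) => //=; lia.
  have : (q * M.+1 ^ 2 <= q * y ^ 2)%N by rewrite leq_mul2l leq_exp2r// yM orbT.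
  have -> : q%:Z * y%:Z ^+ 2 = (q * y ^ 2)%N%:Z by rewrite PoszM -mulnn expr2 PoszM.
  by lia.
rewrite big_image /=; apply: eq_bigr => y _; rewrite /F.
have yM : (q * y.+1 ^ 2 <= q * M ^ 2)%N by rewrite leq_mul2l leq_exp2r// ltn_ord orbT.
have -> : x + 1 * y.+1%:R = ((x : nat)%:Z + y.+1%:Z)%:~R.
  by rewrite intrD -natr_ord_val mul1r.
have sqE : q%:Z * y.+1%:Z ^+ 2 = (q * y.+1 ^ 2)%N%:Z.
  by rewrite PoszM -mulnn expr2 PoszM.
have -> : x + q%:R * y.+1%:R ^+ 2 = ((x : nat)%:Z + (q * y.+1 ^ 2)%N%:Z)%:~R.
  by rewrite intrD -natr_ord_val -[(_)%N%:Z%:~R]/((q * y.+1 ^ 2)%:R) natrM natrX.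
rewrite sqE !periodiseE//; first by lia.
by move: (ltn_ord y); lia.
Qed.

Lemma quadratic_count_avg (q M : nat) g0 g1 f :
  supported_in g0 (initial_segment N) -> supported_in g1 (initial_segment N) ->
  supported_in f (initial_segment N) -> (0 < q)%N -> (0 < M)%N -> (N < q * M.+1 ^ 2)%N ->
  (q * M ^ 2 <= N)%N -> (N + N < w)%N ->
  modulus (quadratic_count q g0 g1 f) = W%:R * M%:R *
   modulus (\avg_(y < M) \avg_(x : G) (periodise g0 x * periodise g1 (x + 1 * y.+1%:R) *
     periodise f (x + q%:R * y.+1%:R ^+ 2))).
Proof.
move=> s0 s1 sf q0 M0 NM MN Nw; rewrite (quadratic_count_periodise s0 s1 sf q0 NM MN Nw).
rewrite exchange_avg /avg !card_ord -mulr_suml !modulusM !modulusV !modulus_nat.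
set z := modulus _.
have n1 : M%:R != 0 :> R by rewrite pnatr_eq0; lia.
have n2 : W%:R != 0 :> R by rewrite pnatr_eq0.
by rewrite mulrC -!mulrA mulKf// mulVf// mulr1.
Qed.

End Embedding.

(** * Assembly *)
Section Assembly.
Variable R : realType.
Local Notation C := R[i].
Implicit Types (f g : int -> C).

Lemma sum_interval (n a b : nat) : (a <= b <= n)%N ->
  \sum_(i < n) ((a <= i < b)%N : nat) = (b - a)%N.
Proof.
move=> abn; suff -> : \sum_(i < n) ((a <= i < b)%N : nat) = (minn n b - minn n a)%N by lia.
have ab : (a <= b)%N by case/andP: abn.
elim: n {abn} => [|n IHn]; first by rewrite big_ord0 !min0n.
by rewrite big_ord_recr /= IHn; case: (boolP (a <= n < b)%N) => /=; lia.
Qed.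

Lemma ler_sum_inj (I J : finType) (phi : I -> J) (F : J -> R) : injective phi ->
  (forall j, 0 <= F j) -> \sum_i F (phi i) <= \sum_j F j.
Proof.
move=> phiI F0; have -> : \sum_i F (phi i) = \sum_(j in [set phi i | i in [set: I]]%SET) F j.
  rewrite big_imset /=; last by move=> i j _ _; exact: phiI.
  by apply: eq_bigl => i; rewrite inE.
by rewrite [leLHS]big_mkcond /=; apply: ler_sum => j _; case: ifP.
Qed.

(** For 1 <= x <= 3 N / 4 and y <= M / 2 all three points lie in the interval,
    since y <= q y^2 <= N / 4. *)
Lemma quadratic_count_one (w N q M : nat) : (0 < q)%N -> (1 < M)%N ->
  (N < q * M.+1 ^ 2)%N -> (q * M ^ 2 <= N)%N -> (N + N < w)%N ->
  exists n : nat, quadratic_count q (indicator R (initial_segment N))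
      (indicator R (initial_segment N)) (indicator R (initial_segment N)) = n%:R /\
    (N * M <= 4 * n)%N.
Proof.
move=> q0 M1 NM MN Nw; have s1 := @supported_one R N.
have leMN : (M <= N)%N by apply: leq_trans MN; rewrite -mulnn; nia.
pose c (z : nat) := (1 <= z <= N)%N.
have cE (z : 'I_w.+2) : periodise (w := w) (indicator R (initial_segment N)) z = (c z)%:R.
  rewrite /periodise /indicator indicE; congr (_%:R); congr nat_of_bool.
  by apply/idP/idP => [/set_mem|cz]; rewrite /initial_segment /c /=;
    [lia|apply/mem_set => /=; move: cz; rewrite /c; lia].
rewrite (quadratic_count_periodise s1 s1 s1 q0 NM MN Nw).
pose B (x : 'I_w.+2) (y : 'I_M) : nat := (c x * c ((x + 1 * y.+1%:R)%R : 'I_w.+2) *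
  c ((x + q%:R * y.+1%:R ^+ 2)%R : 'I_w.+2))%N.
exists (\sum_x \sum_y B x y)%N; split.
  rewrite natr_sum; apply: eq_bigr => x _; rewrite natr_sum; apply: eq_bigr => y _.
  by rewrite !cE /B !natrM.
pose X := (N - N %/ 4)%N; pose H := M./2.
have lowB : (\sum_(x < w.+2) \sum_(y < M) ((1 <= x < X.+1) * (0 <= y < H)) <=
    \sum_x \sum_y B x y)%N.
  apply: leq_sum => x _; apply: leq_sum => y _.
  case: (boolP (1 <= x < X.+1)%N) => //= hx; case: (boolP (y < H)%N) => //= hy.
  have qy : (q * y.+1 ^ 2 <= N %/ 4)%N.
    rewrite leq_divRL// -mulnA; apply: leq_trans MN; rewrite leq_mul2l.
    apply/orP; right; have h2 : (2 * y.+1 <= M)%N by rewrite /H in hy; lia.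
    by have := leq_mul h2 h2; rewrite -!mulnn; lia.
  have yq : (y.+1 <= q * y.+1 ^ 2)%N by rewrite -mulnn; nia.
  have natE n : (n < w.+2)%N -> ((n%:R : 'I_w.+2) : nat) = n.
    by move=> nW; rewrite Zp_nat /= modn_small.
  have xE n : (x + n < w.+2)%N -> nat_of_ord ((x : 'I_w.+2) + n%:R)%R = (x + n)%N.
    move=> h; rewrite {1}(natr_ord_val x) -[_%:~R]/((x : nat)%:R) -natrD natE//.
  rewrite /B mul1r -natrX -natrM !xE; [|lia|lia].
  by rewrite /c /X in hx *; lia.
have {lowB} : (X * H <= \sum_x \sum_y B x y)%N.
  apply: leq_trans lowB; under eq_bigr do rewrite -big_distrr /=.
  rewrite -big_distrl /= (sum_interval (a := 1)); last by rewrite /X; lia.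
  by rewrite (@sum_interval M 0 H) /H; lia.
move: (\sum_x _)%N => S; have h1 : (3 * N <= 4 * X)%N by rewrite /X; lia.
have h2 : (M <= 3 * H)%N by rewrite /H; lia.
by have := leq_mul h1 h2; nia.
Qed.

(** Jensen's inequality over the quadruples, then Cauchy-Schwarz over the residue
    classes; the quadruples of multiples of 2 q that occur are among all
    quadruples of integers in a window, and the terms of the norm are
    nonnegative. *)
Lemma cube_corr_gowers (w N q M : nat) f : (0 < N)%N -> (0 < q)%N -> (0 < M)%N ->
  (q * M ^ 2 <= N)%N -> (w.+2 = 200 * N)%N ->
  supported_in f (initial_segment N) ->
  cube_corr (16 * M ^ 2) (q%:R * 2 : 'I_w.+2) (periodise (w := w) f) ^+ 2 *
    ((32 * M ^ 2)%:R ^+ 4 * (200 * N)%:R ^+ 2)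
  <= q%:R * \sum_(1 <= u < q.+1)
       local_gowers_norm 5 (residue_class u%:Z q) f ^+ (2 ^ 5).
Proof.
move=> N0 q0 M0 MN wN sf.
pose L := (16 * M ^ 2)%N; pose n := (2 * L)%N.
pose kk (i : 'I_n) : int := (2 * q)%N%:Z * ((i : nat)%:Z - L%:Z).
pose K : finType := ('I_n * ('I_n * ('I_n * 'I_n)))%type.
pose hh (p : K) : seq int := [:: kk p.2.2.2; kk p.2.2.1; kk p.2.1; kk p.1].
have qL : (2 * q * L <= 32 * N)%N by rewrite /L; lia.
have kk_le i : (`|kk i| <= 32 * N)%N.
  rewrite /kk abszM; apply: leq_trans qL; rewrite leq_mul2l; apply/orP; right.
  by move: (ltn_ord i); rewrite /n; lia.
have corrE (k1 k2 k3 k4 : 'I_n) :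
    let r := q%:R * 2 : 'I_w.+2 in let v (i : 'I_n) := (i : nat)%:Z - L%:Z in
    autocorr (mder (r * (v k3)%:~R) (mder (r * (v k2)%:~R) (mder (r * (v k1)%:~R)
      (periodise (w := w) f)))) (r * (v k4)%:~R) =
    modulus (int_sum (mul_diffs (hh (k1, (k2, (k3, k4)))) f)) / (200 * N)%:R.
  move=> r v; rewrite (@int_sum_mul_diffs _ w N)//; last first.
    by rewrite /abs_sum /=; move: (kk_le k1) (kk_le k2) (kk_le k3) (kk_le k4); lia.
  rewrite /autocorr /avg modulusM modulusV modulus_nat card_ord wN; congr (modulus _ / _).
  have rE i : r * (v i)%:~R = (kk i)%:~R.
    by rewrite /kk intrM -[(2 * q)%N%:Z%:~R]/((2 * q)%:R) natrM /r [2%:R * _]mulrC.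
  by rewrite !rE.
set cc := cube_corr _ _ _.
have ccE : cc ^+ 2 * (n%:R ^+ 4 * (200 * N)%:R ^+ 2) <=
    \sum_(p : K) modulus (int_sum (mul_diffs (hh p) f)) ^+ 2.
  pose F k1 k2 k3 k4 : R := modulus (int_sum (mul_diffs (hh (k1, (k2, (k3, k4)))) f)) / (200 * N)%:R.
  have -> : cc = \avg_k1 \avg_k2 \avg_k3 \avg_k4 F k1 k2 k3 k4.
    apply: eq_avg => k1; apply: eq_avg => k2; apply: eq_avg => k3; apply: eq_avg => k4.
    exact: corrE.
  set A := avg _.
  have A2 : A ^+ 2 <= \avg_(p : K) F p.1 p.2.1 p.2.2.1 p.2.2.2 ^+ 2.
    rewrite -(pair_avg (fun k1 (p : 'I_n * ('I_n * 'I_n)) => F k1 p.1 p.2.1 p.2.2 ^+ 2)).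
    apply: le_trans (avg_sqr_le _) _; apply: ler_avg => k1.
    rewrite -(pair_avg (fun k2 (p : 'I_n * 'I_n) => F k1 k2 p.1 p.2 ^+ 2)).
    apply: le_trans (avg_sqr_le _) _; apply: ler_avg => k2.
    rewrite -(pair_avg (fun k3 k4 => F k1 k2 k3 k4 ^+ 2)).
    apply: le_trans (avg_sqr_le _) _; apply: ler_avg => k3.
    exact: avg_sqr_le.
  have n0 : n%:R != 0 :> R by rewrite pnatr_eq0 /n /L -mulnn; nia.
  have W0 : (200 * N)%:R != 0 :> R by rewrite pnatr_eq0; lia.
  have c0 : 0 <= n%:R ^+ 4 * (200 * N)%:R ^+ 2 :> R by rewrite mulr_ge0 ?exprn_ge0.
  have cK : #|{: K}|%:R = n%:R ^+ 4 :> R.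
    by rewrite !card_prod card_ord -natrX; congr _%:R; rewrite !expnS expn0 muln1.
  apply: le_trans (ler_wpM2r c0 A2) _; rewrite /avg cK mulr_suml mulr_suml.
  apply: ler_sum => -[k1 [k2 [k3 k4]]] _; rewrite /F /=.
  move: (modulus _) n0 W0 => z; move: (n%:R : R) ((200 * N)%:R : R) => a b a0 b0.
  have -> : (z / b) ^+ 2 / a ^+ 4 * (a ^+ 4 * b ^+ 2) = z ^+ 2; last by [].
  by field; rewrite ?a0 ?b0.
rewrite (_ : (32 * M ^ 2)%N = n); last by rewrite /n /L; lia.
apply: le_trans ccE _.
have qk i : (q%:Z %| kk i)%Z.
  by rewrite /kk PoszM -mulrA; apply: dvdz_mull; exact: dvdz_mulr.
have qd p : all (fun a => (q%:Z %| a)%Z) (hh p) by rewrite /= !qk.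
apply: (le_trans (y := \sum_(p : K) q%:R * \sum_(1 <= u < q.+1)
    modulus (int_sum (mul_diffs (hh p) (restrict q u f))) ^+ 2)).
  by apply: ler_sum => p _; exact: (modulus_int_sum_sqr q0 sf).
rewrite -mulr_sumr ler_wpM2l// exchange_big /=; apply: ler_sum => u _.
rewrite /local_gowers_norm -/(restrict q u f).
have leP : (N <= 32 * N)%N by lia.
rewrite (gowers_norm5E (@supported_restrict _ N q u f sf) leP).
have lt_k i : (`|(kk i + (32 * N)%N%:Z)%R| < (2 * (32 * N)).+1)%N by have := kk_le i; lia.
pose j i : 'I_(2 * (32 * N)).+1 := Ordinal (lt_k i).
have jE i : shift_ord (j i) = kk i.
  by rewrite /shift_ord /=; have := kk_le i; lia.
pose io (p : K) : 4.-tuple 'I_(2 * (32 * N)).+1 :=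
  [tuple j p.2.2.2; j p.2.2.1; j p.2.1; j p.1].
have jI : injective j.
  move=> i1 i2 /(congr1 (@shift_ord _)); rewrite !jE /kk => /mulfI h.
  by apply: val_inj => /=; have := h _; lia.
have ioI : injective io.
  move=> [k1 [k2 [k3 k4]]] [l1 [l2 [l3 l4]]] /(congr1 val) /=.
  by move=> [] /= e4 e3 e2 e1; congr (_, (_, (_, _))); apply: jI; apply: val_inj.
have := @ler_sum_inj K _ io (fun t => modulus (int_sum (mul_diffs
  (map (@shift_ord (32 * N)) t) (restrict q u f))) ^+ 2) ioI.
move=> h; apply: le_trans (h _); last by move=> t; rewrite exprn_ge0 ?modulus_ge0.
by apply: ler_sum => p _; rewrite /= !jE.
Qed.

End Assembly.

Lemma floor_sqrt (N q : nat) : (0 < q)%N ->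
  exists M : nat, (q * M ^ 2 <= N)%N /\ (N < q * M.+1 ^ 2)%N.
Proof.
move=> q0; have ex : exists M, (q * M ^ 2 <= N)%N by exists 0%N; rewrite muln0.
have bd M : (q * M ^ 2 <= N)%N -> (M <= N)%N.
  by move=> h; apply: leq_trans h; rewrite -mulnn; nia.
case: (ex_maxnP ex bd) => M hM maxM; exists M; split=> //.
by rewrite ltnNge; apply/negP => /maxM; rewrite ltnn.
Qed.

(** In the application x = N / q, W = 200 N is the order of the cyclic group and
    m = 32 M^2 is the number of values of each shift. *)
Lemma final_arithmetic (R : realType) (c A delta lam x m W S T cc : R) (q D : nat) :
  0 < c -> 0 < A -> 0 < delta -> (0 < q)%N -> 0 < x -> lam <= 1 -> delta / A <= lam ->
  c * lam ^+ D <= cc -> cc ^+ 2 * (m ^+ 4 * W ^+ 2) <= q%:R * S ->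
  8 * x <= m -> W = 200%:R * (q%:R * x) -> T <= q%:R * (4 * x) ^+ 6 ->
  c ^+ 2 / A ^+ (2 * D + 4) * delta ^+ (2 * D + 4) * T <= S.
Proof.
move=> c0 A0 d0 q0 x0 lam1 dlam ccl ccS mx WE TX.
have qr : 0 < q%:R :> R by rewrite ltr0n.
set E := (2 * D + 4)%N; pose Y := c ^+ 2 * (delta / A) ^+ E.
have dA : 0 < delta / A by rewrite divr_gt0.
have Y0 : 0 <= Y by rewrite /Y mulr_ge0 ?exprn_ge0// ltW.
have lam0 : 0 < lam by exact: lt_le_trans dlam.
have Ycc : Y <= cc ^+ 2.
  apply: (le_trans (y := (c * lam ^+ D) ^+ 2)); last first.
    by apply: ler_expr_nonneg => //; rewrite mulr_ge0 ?exprn_ge0// ltW.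
  rewrite exprMn -exprM; apply: ler_wpM2l; first by rewrite exprn_ge0// ltW.
  apply: (le_trans (y := lam ^+ E)); first by apply: ler_expr_nonneg => //; exact: ltW.
  by apply: ler_wiXn2l; [exact: ltW|exact: lam1|rewrite /E mulnC leq_addr].
have -> : c ^+ 2 / A ^+ E * delta ^+ E * T = Y * T.
  by rewrite /Y expr_div_n; congr (_ * _); rewrite mulrAC mulrA.
apply: (le_trans (y := Y * (q%:R * (4 * x) ^+ 6))); first exact: ler_wpM2l.
rewrite -(ler_pM2l qr); apply: le_trans ccS.
apply: (le_trans (y := Y * ((8 * x) ^+ 4 * W ^+ 2))); last first.
  apply: ler_pM => //; first by rewrite mulr_ge0 ?exprn_even_ge0.
  by apply: ler_wpM2r; [rewrite exprn_even_ge0|apply: ler_expr_nonneg; rewrite ?mulr_ge0// ltW].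
have -> : q%:R * (Y * (q%:R * (4 * x) ^+ 6)) = Y * (x ^+ 6 * q%:R ^+ 2 * 4 ^+ 6) by ring.
apply: ler_wpM2l => //; rewrite WE.
have -> : (8 * x) ^+ 4 * (200%:R * (q%:R * x)) ^+ 2 =
   x ^+ 6 * q%:R ^+ 2 * (8 ^+ 4 * 200%:R ^+ 2) by ring.
apply: ler_wpM2l; first by rewrite mulr_ge0 ?exprn_ge0// ltW.
have -> : 8 ^+ 4 = 4 ^+ 6 :> R by ring.
by apply: ler_peMr; [exact: exprn_ge0|apply: exprn_ege1; rewrite ler1n].
Qed.

Theorem theorem5p6 (R : realType) :
  exists c C : R, [/\ 0 < c, 0 < C &
    forall (N q : nat) (delta : R) (g0 g1 f : int -> R[i]),
      (0 < N)%N -> (0 < q)%N -> 0 < delta ->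
      one_bounded g0 -> one_bounded g1 -> one_bounded f ->
      supported_in g0 (initial_segment N) ->
      supported_in g1 (initial_segment N) ->
      supported_in f (initial_segment N) ->
      let oneN := indicator R (initial_segment N) in
      delta%:C%C * quadratic_count q oneN oneN oneN
        <= `|quadratic_count q g0 g1 f| ->
      N%:R <= C * q%:R \/
      c * delta `^ C *
        (\sum_(1 <= u < q.+1)
            local_gowers_norm 5 (residue_class u%:Z q) oneN ^+ (2 ^ 5))
      <= \sum_(1 <= u < q.+1)
            local_gowers_norm 5 (residue_class u%:Z q) f ^+ (2 ^ 5)].
Proof.
have [c [D [c0 main]]] := group_quadratic_control R.
pose E := (2 * D + 4)%N.
have [A [A0 AE]] : exists A : R, 0 < A /\ A = 800%:R by exists 800%:R; rewrite ltr0n.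
have E0 : 0 < A ^+ E by exact: exprn_gt0.
exists (c ^+ 2 / A ^+ E), E%:R; split.
- by rewrite divr_gt0// exprn_gt0.
- by rewrite ltr0n /E addn_gt0 orbT.
move=> N q delta g0 g1 f N0 q0 d0 b0 b1 bf s0 s1 sf; cbv zeta => hyp.
have [NEq|NEq] := leP N%:R (E%:R * q%:R); [by left|right].
have {NEq} qN : (4 * q < N)%N.
  move: NEq; rewrite -natrM ltr_nat; apply: leq_ltn_trans.
  by rewrite leq_mul2r /E leq_addl orbT.
have [M [MN NM]] := floor_sqrt N q0.
have M1 : (1 < M)%N.
  rewrite ltnNge; apply/negP => M1; have : (M.+1 ^ 2 <= 2 ^ 2)%N by rewrite leq_exp2r.
  by move=> /(leq_mul (leqnn q)); lia.
have M0 : (0 < M)%N by lia.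
have [w wN] : exists w, (w.+2 = 200 * N)%N by exists (200 * N - 2)%N; lia.
have Nw : (N + N < w)%N by lia.
have [n [Qn nM]] := quadratic_count_one R q0 M1 NM MN Nw.
have := @quadratic_count_avg R w N q M g0 g1 f s0 s1 sf q0 M0 NM MN Nw.
set lam := modulus (\avg_(y < M) _) => Qlam.
have {hyp} hyp : delta * n%:R <= (200 * N)%:R * M%:R * lam.
  rewrite -wN -Qlam -lecR rmorphM /= rmorph_nat modulusE -Qn; exact: hyp.
have lam0 : 0 <= lam by exact: modulus_ge0.
have bb0 : bounded1 (periodise (w := w) g0) by move=> x; exact: modulus_one_bounded.
have bb1 : bounded1 (periodise (w := w) g1) by move=> x; exact: modulus_one_bounded.
have bbf : bounded1 (periodise (w := w) f) by move=> x; exact: modulus_one_bounded.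
have lam1 : lam <= 1.
  by apply: bounded1_avg => y; apply: bounded1_avg => x; do ! apply: modulusM_le1.
have Nr : 0 < N%:R :> R by rewrite ltr0n.
have Mr : 0 < M%:R :> R by rewrite ltr0n.
have qr : 0 < q%:R :> R by rewrite ltr0n.
have lamd : delta / A <= lam.
  rewrite ler_pdivrMr// AE -(ler_pM2r (_ : 0 < N%:R * M%:R / 4)); last first.
    by rewrite divr_gt0 ?mulr_gt0.
  have h1 : N%:R * M%:R / 4 <= n%:R :> R.
    by rewrite ler_pdivrMr// -!natrM ler_nat mulnC [leqRHS]mulnC mulnC.
  apply: (le_trans (y := delta * n%:R)); first by rewrite ler_wpM2l// ltW.
  apply: le_trans hyp _; rewrite natrM le_eqVlt; apply/orP; left; apply/eqP.
  have -> : 800%:R = 200%:R * 4 :> R by rewrite -natrM.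
  by field.
have := main ('I_w.+2) M _ _ _ 1 q%:R M0 bb0 bb1 bbf; rewrite -/lam => cub.
have ccS := cube_corr_gowers N0 q0 M0 MN wN sf.
have X0 : 0 < N%:R / q%:R :> R by rewrite divr_gt0.
rewrite powR_mulrn; last exact: ltW.
apply: (final_arithmetic (x := N%:R / q%:R) c0 A0 d0 q0 X0 lam1 lamd cub ccS).
- rewrite mulrA ler_pdivrMr// -!natrM ler_nat.
  have h1 : (M.+1 ^ 2 <= 4 * M ^ 2)%N.
    by rewrite -(expnMn 2 M 2) leq_exp2r// mul2n -addnn -addn1 leq_add2l.
  have h2 := leq_trans (ltnW NM) (leq_mul (leqnn q) h1).
  by rewrite (_ : 32 * M ^ 2 * q = 8 * (q * (4 * M ^ 2)))%N ?leq_mul2l// -[32%N]/(8 * 4)%N;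
     clear; lia.
- by rewrite [RHS]mulrC mulrC natrM [q%:R * _]mulrC divfK ?gt_eqF// mulrC.
- apply: (le_trans (y := \sum_(1 <= u < q.+1) (4 * (N%:R / q%:R)) ^+ 6)).
    apply: ler_sum => u _; apply: (@local_gowers_one_le R N q u).
    by rewrite q0 -(leq_add2r 0) !addn0; apply: leq_trans (ltnW qN); rewrite leq_pmull.
  by rewrite sumr_const_nat subn1 /= [leRHS]mulr_natl.
Qed.
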